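(* Let $a_1, a_2 \in \mathscr{A}$ and suppose that $k := a_2/a_1 \in H^{\infty}$. Then $$\mathfrak{M}(\overline{a_1}, \overline{a_2}) = k\,(\mathscr{M}(\overline{a_1}) \cap H^{\infty}) = \{k\psi : \psi\in \mathscr{M}(\overline{a_1}) \cap H^{\infty}\}.$$
   Context: Let $\mathbb{D}=\{|z|<1\}$, $\mathbb{T}=\partial\mathbb{D}$, let $\mathscr{O}(\mathbb{D})$ be the set of analytic functions on $\mathbb{D}$, $H^2$ the Hardy space of $\mathbb{D}$ (identified with a closed subspace of $L^2=L^2(\mathbb{T},d\theta/2\pi)$ via radial boundary values), and $H^\infty$ the bounded analytic functions on $\mathbb{D}$. For $a\in H^\infty$, the co-analytic Toeplitz operator $T_{\overline a}:H^2\to H^2$ is $T_{\overline a}f=P_+(\overline a f)$, where $P_+$ is the orthogonal projection of $L^2$ onto $H^2$. The range space of $T_{\overline a}$ is $\mathscr{M}(\overline a):=T_{\overline a}H^2$. For $a_1,a_2\in H^\infty$, the set of multipliers is $$\mathfrak{M}(\overline{a_1},\overline{a_2}):=\{\phi\in\mathscr{O}(\mathbb{D}):\ \forall f\in\mathscr{M}(\overline{a_1}),\ \phi f\in\mathscr{M}(\overline{a_2})\}.$$ $\mathscr{A}$ denotes the set of polynomials of the form $a(z)=\prod_{j=1}^{N}(z-\zeta_j)$ with $\zeta_j\in\mathbb{T}$ (not necessarily distinct), the case $N=0$ (empty product, $a=1$) being allowed. *)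

(* Defs.v *)
From HB Require Import structures.
From mathcomp Require Import all_boot all_order all_algebra.
From mathcomp Require Import all_classical all_reals all_analysis.
From mathcomp Require Import complex.

Set Implicit Arguments.
Unset Strict Implicit.
Unset Printing Implicit Defensive.

Import Order.TTheory GRing.Theory Num.Theory.
Import numFieldNormedType.Exports.

Local Open Scope classical_set_scope.
Local Open Scope ring_scope.

(* Functions on the open unit disk are functions on this subtype, so that two
   such functions are equal as soon as they agree at every point of the disk. *)
Definition disk (R : realType) : Type := {z : R[i] | `|z| < 1}.

(* The real-valued modulus; `|z| is its image in R[i]. *)
Definition modulus (R : realType) (z : R[i]) : R := ComplexField.Normc.normc z.

(* f is the sum on the whole disk of a power series centred at 0. The R[i]^o
   annotation selects the topology defined by the modulus. *)
Definition analytic (R : realType) (f : disk R -> R[i]) : Prop :=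
  exists c : nat -> R[i], forall z : disk R,
    series (fun n => c n * val z ^+ n) @ \oo --> (f z : R[i]^o).

Definition polar (R : realType) (r t : R) : R[i] :=
  Complex (r * cos t) (r * sin t).

(* f (r e^(it)); the default value 0 is used only when r e^(it) is not in the
   disk. *)
Definition dilate (R : realType) (f : disk R -> R[i]) (r t : R) : R[i] :=
  oapp f 0 (insub (polar r t)).

Definition Hinfty (R : realType) : set (disk R -> R[i]) :=
  [set f | analytic f /\ exists M : R, forall z, modulus (f z) <= M].

(* The unit circle is parametrized by t |-> e^(it); functions on the circle are
   represented by functions of the angle t, of which only the values for
   t in [-pi, pi] matter. *)
Definition angles (R : realType) : set R := `[- pi, pi]%classic.
Arguments angles R : clear implicits.

Definition H2 (R : realType) : set (disk R -> R[i]) :=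
  [set f | analytic f /\ exists M : R, forall r : R, 0 <= r < 1 ->
    (\int[lebesgue_measure]_(t in angles R)
       (modulus (dilate f r t) ^+ 2)%:E <= M%:E)%E].

(* Square-integrable functions on the circle, not quotiented by equality almost
   everywhere. *)
Definition L2 (R : realType) : set (R -> R[i]) :=
  [set F | [/\ measurable_fun (angles R) (fun t => complex.Re (F t)),
               measurable_fun (angles R) (fun t => complex.Im (F t)) &
               (\int[lebesgue_measure]_(t in angles R)
                  (modulus (F t) ^+ 2)%:E < +oo)%E]].

(* The integral of F against dt / (2 pi). *)
Definition circle_mean (R : realType) (F : R -> R[i]) : R[i] :=
  Complex
    ((pi *+ 2)^-1 * \int[lebesgue_measure]_(t in angles R) complex.Re (F t))
    ((pi *+ 2)^-1 * \int[lebesgue_measure]_(t in angles R) complex.Im (F t)).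

Definition inner (R : realType) (F G : R -> R[i]) : R[i] :=
  circle_mean (fun t => F t * conjc (G t)).

(* F represents in L2 the radial boundary values of f. *)
Definition boundary_value (R : realType) (f : disk R -> R[i]) (F : R -> R[i])
    : Prop :=
  L2 F /\
  {ae lebesgue_measure, forall t : R, angles R t ->
     dilate f r t @[r --> (1 : R)^'-] --> (F t : R[i]^o)}.

(* H^2 as a subspace of L2. *)
Definition H2_circle (R : realType) : set (R -> R[i]) :=
  [set F | exists2 f, H2 f & boundary_value f F].

(* G represents P_+ F, the orthogonal projection of F onto H^2. *)
Definition is_Pplus (R : realType) (F G : R -> R[i]) : Prop :=
  H2_circle G /\
  forall H, H2_circle H -> inner (fun t => F t - G t) H = 0.

(* The graph of T_(conj a): g = P_+ (conj a . f) in H^2, computed with boundary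
   values. *)
Definition coToeplitz (R : realType) (a f g : disk R -> R[i]) : Prop :=
  [/\ H2 f, H2 g & exists A F G : R -> R[i],
      [/\ boundary_value a A, boundary_value f F, boundary_value g G &
          is_Pplus (fun t => conjc (A t) * F t) G]].

Definition range_space (R : realType) (a : disk R -> R[i]) :
    set (disk R -> R[i]) :=
  [set g | exists f, coToeplitz a f g].

Definition multipliers (R : realType) (a1 a2 : disk R -> R[i]) :
    set (disk R -> R[i]) :=
  [set phi | analytic phi /\
     forall f, range_space a1 f -> range_space a2 (fun z => phi z * f z)].

Definition circle_rooted (R : realType) : set {poly R[i]} :=
  [set a | exists2 s : seq R[i], (forall zeta, zeta \in s -> `|zeta| = 1) &
                                 a = \prod_(zeta <- s) ('X - zeta%:P)].

Definition poly_on_disk (R : realType) (a : {poly R[i]}) : disk R -> R[i] :=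
  fun z => a.[val z].

(* Main.v *)
(* On the circle, conj a = c z^(-N) a for a = prod (z - zeta_j), so T_(conj a) is
   c times the N-th backward shift of multiplication by a, whence
   M(conj a) = a H^2 + polynomials.  As k is bounded, a1 divides a2 and k is a
   polynomial; the inclusion of k (M(conj a1) cap H^oo) in the multipliers is
   then a computation.

   Let phi = a2 g + p be a multiplier.  For h in H^2, phi a1 h lies in
   a2 H^2 + polynomials, and comparing growth along radii ending at a zero of k,
   with h unbounded there, forces k to divide p.  So psi = phi / k lies in
   M(conj a1), and the same growth comparison gives psi h in H^2 for every h.  A
   gliding hump built from Cauchy kernels at points accumulating at a single
   point of the circle then shows that psi is bounded; such a sum has evident
   radial limits off that point. *)
Require Import Defs.
From HB Require Import structures.
From mathcomp Require Import all_boot all_order all_algebra.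
From mathcomp Require Import all_classical all_reals all_analysis.
From mathcomp Require Import measurable_realfun.
From mathcomp Require Import complex ring lra.

Import Order.TTheory GRing.Theory Num.Theory.
Import numFieldNormedType.Exports.

Local Open Scope classical_set_scope.
Local Open Scope ring_scope.

Set Implicit Arguments.
Unset Strict Implicit.
Unset Printing Implicit Defensive.

(** [range_space] asks for explicit boundary values, so every function handed to a multiplier must
    come with its radial limits. This shapes the test functions: boundedness of psi is not drawn
    from a closed graph argument over all of H^2, but tested on one function h, adapted to the
    points where psi is large and known on the circle.

    The comparisons have to identify expansions a h + p with different polynomial parts, while
    products of two H^2 functions leave H^2. One growth class settles both, o(1 / (1 - |z|))
    ([tame]): it contains these products, and a member multiplied by z - x tends to 0 along the
    radius to x. Hence, if a polynomial is a in the class A times a tame function, that function is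
    itself a polynomial.

    Every h in H^2 satisfies (1 - |z|) |h(z)|^2 -> 0 at the circle, so no h keeps this quantity away
    from 0 along a sequence tending to the circle. The hump keeps it above 9^-n / 8 at the n-th
    point; since this rate is known beforehand, the points can be chosen to outrun it. *)

(** * Complex modulus and limits *)

(* The limit is an element of R[i] rather than of R[i]^o, so that the sums and
   products of limits below are those of R[i]. *)
Definition tends (R : realType) (T : Type) (F : set_system T) (f : T -> R[i])
  (l : R[i]) : Prop := f @ F --> (l : R[i]^o).

Section ComplexModulus.
Variable R : realType.
Implicit Types (x y z : R[i]) (r : R).

Lemma normcE_modulus z : `|z| = (modulus z)%:C%C.
Proof. by []. Qed.

Lemma modulus_ge0 z : 0 <= modulus z.
Proof. by rewrite -ler0c -normcE_modulus normr_ge0. Qed.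

Lemma normc_lt z r : (`|z| < r%:C%C) = (modulus z < r).
Proof. by rewrite normcE_modulus ltcR. Qed.

Lemma norm_lt1 z : (`|z| < 1) = (modulus z < 1).
Proof. exact: (normc_lt z 1). Qed.

Lemma modulus0 : modulus (0 : R[i]) = 0.
Proof. exact: ComplexField.Normc.normc0. Qed.

Lemma modulus1 : modulus (1 : R[i]) = 1.
Proof. exact: ComplexField.Normc.normc1. Qed.

Lemma modulus_eq0 z : (modulus z == 0) = (z == 0).
Proof.
by apply/eqP/eqP => [/ComplexField.Normc.eq0_normc //|->]; rewrite modulus0.
Qed.

Lemma modulusM x y : modulus (x * y) = modulus x * modulus y.
Proof. exact: ComplexField.Normc.normcM. Qed.

Lemma modulusV x : modulus x^-1 = (modulus x)^-1.
Proof. exact: ComplexField.Normc.normcV. Qed.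

Lemma modulusN x : modulus (- x) = modulus x.
Proof. exact: normcN. Qed.

Lemma modulusB x y : modulus (x - y) = modulus (y - x).
Proof. by rewrite -modulusN opprB. Qed.

Lemma modulusX x n : modulus (x ^+ n) = modulus x ^+ n.
Proof. by elim: n => [|n IH]; rewrite ?modulus1 // !exprS modulusM IH. Qed.

Lemma le_modulusD x y : modulus (x + y) <= modulus x + modulus y.
Proof. exact: le_normcD. Qed.

Lemma le_modulusB x y : modulus (x - y) <= modulus x + modulus y.
Proof. by rewrite -(modulusN y); exact: le_modulusD. Qed.

Lemma lerB_modulus x y : modulus x - modulus y <= modulus (x - y).
Proof. by rewrite lerBlDr; apply: le_trans (le_modulusD _ _); rewrite subrK. Qed.

Lemma dist_modulus x y : `|modulus x - modulus y| <= modulus (x - y).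
Proof.
by rewrite ler_norml lerB_modulus andbT lerNl opprB modulusB lerB_modulus.
Qed.

Lemma modulus_conj x : modulus (conjc x) = modulus x.
Proof. by case: x => a b; rewrite /modulus /= sqrrN. Qed.

Lemma modulus_real r : modulus (r%:C%C) = `|r|.
Proof. by rewrite /modulus /= expr0n /= addr0 sqrtr_sqr. Qed.

Lemma modulus_sqr z : modulus z ^+ 2 = complex.Re z ^+ 2 + complex.Im z ^+ 2.
Proof.
by case: z => a b; rewrite /modulus /= sqr_sqrtr// addr_ge0// sqr_ge0.
Qed.

Lemma mulc_conj z : z * conjc z = (modulus z ^+ 2)%:C%C.
Proof. by rewrite rmorphXn /= -normcE_modulus sqr_normc. Qed.

Lemma conjc_inv_modulus z : modulus z = 1 -> conjc z = z^-1.
Proof.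
move=> z1; have z0 : z != 0 by rewrite -modulus_eq0 z1 oner_eq0.
by apply: (mulfI z0); rewrite mulc_conj z1 expr1n divff.
Qed.

Lemma Re_le_modulus z : `|complex.Re z| <= modulus z.
Proof.
rewrite -(@ler_pXn2r _ 2) ?nnegrE ?modulus_ge0//.
by rewrite modulus_sqr real_normK ?num_real// lerDl sqr_ge0.
Qed.

Lemma Im_le_modulus z : `|complex.Im z| <= modulus z.
Proof.
rewrite -(@ler_pXn2r _ 2) ?nnegrE ?modulus_ge0//.
by rewrite modulus_sqr real_normK ?num_real// lerDr sqr_ge0.
Qed.

Lemma modulus_le_ReIm z : modulus z <= `|complex.Re z| + `|complex.Im z|.
Proof.
rewrite -(@ler_pXn2r _ 2) ?nnegrE ?modulus_ge0 ?addr_ge0//.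
rewrite modulus_sqr sqrrD !real_normK ?num_real//.
by rewrite lerD2r lerDl mulrn_wge0// mulr_ge0.
Qed.

Lemma modulus_sum (I : Type) (s : seq I) (P : pred I) (F : I -> R[i]) :
  modulus (\sum_(i <- s | P i) F i) <= \sum_(i <- s | P i) modulus (F i).
Proof.
elim/big_rec2: _ => [|i a b Pi le_ab]; first by rewrite modulus0.
by apply: le_trans (le_modulusD _ _) _; rewrite lerD2l.
Qed.

Lemma Re_sum (I : Type) (s : seq I) (P : pred I) (F : I -> R[i]) :
  complex.Re (\sum_(i <- s | P i) F i) = \sum_(i <- s | P i) complex.Re (F i).
Proof. by apply: (big_morph (@complex.Re R)) => // -[? ?] [? ?]. Qed.

Lemma Im_sum (I : Type) (s : seq I) (P : pred I) (F : I -> R[i]) :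
  complex.Im (\sum_(i <- s | P i) F i) = \sum_(i <- s | P i) complex.Im (F i).
Proof. by apply: (big_morph (@complex.Im R)) => // -[? ?] [? ?]. Qed.

Lemma ReD x y : complex.Re (x + y) = complex.Re x + complex.Re y.
Proof. by case: x => ? ?; case: y. Qed.
Lemma ImD x y : complex.Im (x + y) = complex.Im x + complex.Im y.
Proof. by case: x => ? ?; case: y. Qed.
Lemma ReN x : complex.Re (- x) = - complex.Re x.
Proof. by case: x. Qed.
Lemma ImN x : complex.Im (- x) = - complex.Im x.
Proof. by case: x. Qed.
Lemma ReM x y : complex.Re (x * y) =
  complex.Re x * complex.Re y - complex.Im x * complex.Im y.
Proof. by case: x => ? ?; case: y. Qed.
Lemma ImM x y : complex.Im (x * y) =
  complex.Re x * complex.Im y + complex.Im x * complex.Re y.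
Proof. by case: x => ? ?; case: y. Qed.

Section Convergence.
Context {T : Type} {F : set_system T} {FF : ProperFilter F}.
Implicit Types (f g : T -> R[i]).

Lemma cvgcP f z :
  tends F f z <-> modulus (f t - z) @[t --> F] --> (0 : R).
Proof.
split.
  move=> /(@cvgrPdist_lt _ R[i]^o) fz; apply/cvgrPdist_lt => e e0.
  have := fz e%:C%C; rewrite ltcR => /(_ e0); apply: filterS => t.
  by rewrite normc_lt sub0r normrN ger0_norm ?modulus_ge0// modulusB.
move=> /cvgrPdist_lt fz; apply/(@cvgrPdist_lt _ R[i]^o) => e e0.
(* A positive element of R[i] is real, so complex tolerances are real ones. *)
have eE : e = (complex.Re e)%:C%C by rewrite RRe_real// gtr0_real.
have := fz (complex.Re e); rewrite -ltcR -eE => /(_ e0); apply: filterS => t.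
by rewrite eE normc_lt sub0r normrN ger0_norm ?modulus_ge0// modulusB.
Qed.

Lemma cvgc_modulus f z : tends F f z ->
  modulus (f t) @[t --> F] --> modulus z.
Proof.
move=> /cvgcP /cvgrPdist_lt fz; apply/cvgrPdist_lt => e /fz.
apply: filterS => t; rewrite sub0r normrN ger0_norm ?modulus_ge0//.
by apply: le_lt_trans; rewrite (modulusB (f t)); exact: dist_modulus.
Qed.

Lemma cvgc_Re f z : tends F f z ->
  complex.Re (f t) @[t --> F] --> complex.Re z.
Proof.
move=> /cvgcP /cvgrPdist_lt fz; apply/cvgrPdist_lt => e /fz.
apply: filterS => t; rewrite sub0r normrN ger0_norm ?modulus_ge0//.
by apply: le_lt_trans; rewrite -ReN -ReD modulusB Re_le_modulus.
Qed.

Lemma cvgc_Im f z : tends F f z ->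
  complex.Im (f t) @[t --> F] --> complex.Im z.
Proof.
move=> /cvgcP /cvgrPdist_lt fz; apply/cvgrPdist_lt => e /fz.
apply: filterS => t; rewrite sub0r normrN ger0_norm ?modulus_ge0//.
by apply: le_lt_trans; rewrite -ImN -ImD modulusB Im_le_modulus.
Qed.

Lemma cvgc_ReIm f z : complex.Re (f t) @[t --> F] --> complex.Re z ->
  complex.Im (f t) @[t --> F] --> complex.Im z -> tends F f z.
Proof.
move=> fr fi; apply/cvgcP; apply: (@squeeze_cvgr _ _ _ _ (fun=> 0)
   (fun t => `|complex.Re (f t) - complex.Re z| +
             `|complex.Im (f t) - complex.Im z|)).
- by apply: nearW => t; rewrite modulus_ge0/= -!ReN -!ImN -ReD -ImD
    modulus_le_ReIm.
- exact: cvg_cst.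
rewrite -[X in _ --> X](addr0 0); apply: cvgD.
  by rewrite -(normr0 R) -(subrr (complex.Re z)); apply: cvg_norm;
    apply: cvgB => //; exact: cvg_cst.
by rewrite -(normr0 R) -(subrr (complex.Im z)); apply: cvg_norm;
  apply: cvgB => //; exact: cvg_cst.
Qed.

Lemma eq_tends f g z : f =1 g -> tends F f z -> tends F g z.
Proof. by move=> /funext ->. Qed.

Lemma cvgc_unique f x y :
  tends F f x -> tends F f y -> x = y.
Proof.
move=> fx fy; apply/eqP; rewrite eq_complex; apply/andP; split; apply/eqP.
  exact: (cvg_unique (@Rhausdorff R) (cvgc_Re fx) (cvgc_Re fy)).
exact: (cvg_unique (@Rhausdorff R) (cvgc_Im fx) (cvgc_Im fy)).
Qed.

Lemma cvgcM f g x y : tends F f x -> tends F g y ->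
  tends F (fun t => f t * g t) (x * y).
Proof. exact: cvgM. Qed.

Lemma cvgcD f g x y : tends F f x -> tends F g y ->
  tends F (fun t => f t + g t) (x + y).
Proof. exact: (@cvgD _ R[i]^o). Qed.

Lemma cvgcB f g x y : tends F f x -> tends F g y ->
  tends F (fun t => f t - g t) (x - y).
Proof. exact: (@cvgB _ R[i]^o). Qed.

Lemma cvgc_cst x : tends F (fun=> x) x.
Proof. exact: (@cvg_cst R[i]^o). Qed.

Lemma cvgc_le0 f z (b : T -> R) : (\forall t \near F, modulus (f t - z) <= b t) ->
  b @ F --> (0 : R) -> tends F f z.
Proof.
move=> fb b0; apply/cvgcP; apply: (@squeeze_cvgr _ _ _ _ (fun=> 0) b) => //.
- by near do rewrite modulus_ge0 /=.
- exact: cvg_cst.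
Unshelve. all: by end_near. Qed.

Lemma tends_near_cst f z : (\forall t \near F, f t = z) -> tends F f z.
Proof.
move=> fz; apply: (@cvgc_le0 _ _ (fun=> 0)); last exact: cvg_cst.
by apply: filterS fz => t ->; rewrite subrr modulus0.
Qed.

Lemma cvgc_modulus_le f z (b : R) : tends F f z ->
  (\forall t \near F, modulus (f t) <= b) -> modulus z <= b.
Proof.
move=> /cvgc_modulus fz fb.
by rewrite -(cvg_lim (@Rhausdorff R) fz); apply: limr_le => //; apply/cvg_ex; exists (modulus z).
Qed.

End Convergence.

Lemma tends_shiftn N (u : nat -> R[i]) z :
  tends \oo (fun n => u (n + N)%N) z = tends \oo u z.
Proof. exact: (@cvg_shiftn N R[i]^o u). Qed.

(** Completeness is used in R, on the real and imaginary parts, each dominated by the modulus; the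
    bound then passes to the limit from the partial sums. *)
Lemma cvgc_series_dominated (u : nat -> R[i]) (v : nat -> R) :
  (forall n, modulus (u n) <= v n) -> cvgn (series v) ->
  exists2 l : R[i], tends \oo (series u) l &
                    modulus l <= limn (series v).
Proof.
move=> uv cv.
have cvr : cvgn (series (fun n => complex.Re (u n))).
  apply: normed_cvg; apply: (series_le_cvg _ _ _ cv) => n //=.
  - exact: le_trans (modulus_ge0 (u n)) _.
  - exact: le_trans (Re_le_modulus _) _.
have cvi : cvgn (series (fun n => complex.Im (u n))).
  apply: normed_cvg; apply: (series_le_cvg _ _ _ cv) => n //=.
  - exact: le_trans (modulus_ge0 (u n)) _.
  - exact: le_trans (Im_le_modulus _) _.
exists (Complex (limn (series (fun n => complex.Re (u n))))
                (limn (series (fun n => complex.Im (u n))))).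
  apply: cvgc_ReIm => /=.
    by under eq_fun do rewrite /series /= Re_sum; exact: cvr.
  by under eq_fun do rewrite /series /= Im_sum; exact: cvi.
suff H : tends \oo (series u) (Complex (limn (series (fun n => complex.Re (u n))))
                (limn (series (fun n => complex.Im (u n))))).
  apply: (cvgc_modulus_le H); near=> n.
  apply: le_trans (modulus_sum _ _ _) _.
  apply: le_trans (_ : series v n <= _); first exact: ler_sum.
  apply: nondecreasing_cvgn_le => //.
  apply/nondecreasing_seqP => k; rewrite /series /= big_nat_recr //= lerDl.
  exact: le_trans (modulus_ge0 (u k)) _.
apply: cvgc_ReIm => /=.
  by under eq_fun do rewrite /series /= Re_sum; exact: cvr.
by under eq_fun do rewrite /series /= Im_sum; exact: cvi.
Unshelve. all: by end_near. Qed.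

End ComplexModulus.

(** * Power series on the disk *)

Section PowerSeries.
Variable R : realType.
Implicit Types (f g : disk R -> R[i]) (c d : nat -> R[i]).

(** Both sides run over the pairs with i + j < n, on the left by antidiagonals and on the right by
    rows. *)
Lemma sum_triangle (K : pzRingType) (u v : nat -> K) n :
  \sum_(0 <= k < n) \sum_(0 <= j < k.+1) u j * v (k - j)%N =
  \sum_(0 <= i < n) \sum_(0 <= j < n - i) u i * v j.
Proof.
elim: n => [|n IH]; first by rewrite !big_geq.
rewrite big_nat_recr //= IH [RHS]big_nat_recr //= subSnn big_nat1.
rewrite [X in _ + X = _]big_nat_recr //= subnn addrA; congr (_ + _).
rewrite -big_split /= !big_nat; apply: eq_bigr => i /andP[_ i_n].
rewrite subSn; last exact: ltnW.
by rewrite [in RHS]big_nat_recr //=.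
Qed.

Lemma sum_square_triangle (K : pzRingType) (u v : nat -> K) n :
  (\sum_(0 <= k < n) u k) * (\sum_(0 <= k < n) v k) -
  \sum_(0 <= k < n) \sum_(0 <= j < k.+1) u j * v (k - j)%N =
  \sum_(0 <= i < n) \sum_(n - i <= j < n) u i * v j.
Proof.
rewrite sum_triangle mulr_suml -sumrB; apply: eq_big_nat => i /andP[_ i_n].
rewrite mulr_sumr (big_cat_nat (leq0n _) (leq_subr i n)) /=.
by rewrite [LHS]addrC addKr.
Qed.

Lemma cvg_half : half @ \oo --> \oo.
Proof.
move=> A [N _ NA]; exists N.*2 => // n /= Nn; apply: NA => /=.
by rewrite -(doubleK N) half_leq.
Qed.

Lemma nneg_series_ndecr (u : nat -> R) : (forall n, 0 <= u n) ->
  nondecreasing_seq (series u).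
Proof.
move=> u0; apply/nondecreasing_seqP => k.
by rewrite /series /= big_nat_recr //= lerDl.
Qed.

(* Mertens: the error is bounded by the part of the square [0,n)^2 lying outside
   [0,n/2)^2, applied to the moduli. *)
Lemma cvgc_cauchy_product (u v : nat -> R[i]) (x y : R[i]) :
  cvgn (series (fun n => modulus (u n))) ->
  cvgn (series (fun n => modulus (v n))) ->
  tends \oo (series u) x -> tends \oo (series v) y ->
  tends \oo (series (fun n => \sum_(0 <= j < n.+1) u j * v (n - j)%N)) (x * y).
Proof.
move=> cu cv ux vy.
set w := fun n => _.
rewrite (_ : series w =
    fun n => series u n * series v n - (series u n * series v n - series w n));
  last by apply/funext => n; rewrite subKr.
have xyE : x * y = x * y - 0 by rewrite subr0.
rewrite xyE; apply: cvgcB; first exact: cvgcM.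
set U := series (fun n => modulus (u n)).
set V := series (fun n => modulus (v n)).
apply: (@cvgc_le0 _ _ _ _ _ _ (fun n => U n * V n - U n./2 * V n./2)).
  apply: nearW => n; rewrite subr0 /w /series /= sum_square_triangle.
  rewrite /U /V.
  apply: le_trans (_ : \sum_(0 <= i < n) \sum_(n - i <= j < n)
                         modulus (u i) * modulus (v j) <= _).
    apply: le_trans (modulus_sum _ _ _) _; apply: ler_sum => i _.
    apply: le_trans (modulus_sum _ _ _) _; apply: ler_sum => j _.
    by rewrite modulusM.
  rewrite -(sum_square_triangle (fun n => modulus (u n))
                                (fun n => modulus (v n))).
  rewrite lerD2l lerN2 (sum_triangle (fun n => modulus (u n))
                                      (fun n => modulus (v n))) mulr_suml.
  (* The triangle i + j < n contains the square [0, n/2)^2. *)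
  have hh : (n./2 + n./2 <= n)%N.
    by rewrite addnn -[leqRHS]odd_double_half leq_addl.
  have hn : (n./2 <= n)%N by apply: leq_trans hh; exact: leq_addr.
  rewrite (big_cat_nat _ hn) //= -[leLHS]addr0 lerD ?sumr_ge0//; last first.
    by move=> i _; apply: sumr_ge0 => j _; rewrite mulr_ge0 ?modulus_ge0.
  rewrite !big_nat; apply: ler_sum => i /andP[_ ih].
  have hi : (n./2 <= n - i)%N.
    rewrite leq_subRL; last by rewrite ltnW// (leq_trans ih).
    by apply: leq_trans hh; rewrite leq_add2r ltnW.
  rewrite mulr_sumr (big_cat_nat _ hi) //= lerDl sumr_ge0// => j _.
  by rewrite mulr_ge0 ?modulus_ge0.
rewrite -[X in _ --> X](subrr (limn U * limn V)); apply: cvgB.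
  exact: cvgM.
apply: cvgM; apply: (cvg_comp _ _ cvg_half) => //.
Qed.

(* A copy of val that hides the subtype structure of the disk from unification. *)
Definition coord (z : disk R) : R[i] := val z.

Definition has_coefs f c :=
  forall z : disk R, tends \oo (series (fun n => c n * coord z ^+ n)) (f z).

Lemma poly_on_diskE (p : {poly R[i]}) z : poly_on_disk p z = p.[coord z].
Proof. by []. Qed.

Lemma disk_modulus (z : disk R) : modulus (coord z) < 1.
Proof. by rewrite -norm_lt1; exact: (valP z). Qed.

Definition mkdisk (z : R[i]) (z1 : modulus z < 1) : disk R :=
  exist _ z (eq_ind_r is_true z1 (norm_lt1 z)).

Lemma coord_mkdisk (z : R[i]) (z1 : modulus z < 1) : coord (mkdisk z1) = z.
Proof. by []. Qed.

Lemma disk_coord_inj (z w : disk R) : coord z = coord w -> z = w.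
Proof. exact: val_inj. Qed.

(** Radius of convergence at least 1, in a form that passes at once to shifted sequences. *)
Definition subexponential c :=
  forall s : R, 0 < s < 1 -> exists M, forall n, modulus (c n) * s ^+ n <= M.

(** Abel's lemma: boundedness at the midpoint s of r and 1 leaves a geometric series of ratio r / s
    < 1. *)
Lemma subexponential_cvg c (r : R) : subexponential c -> 0 <= r < 1 ->
  cvgn (series (fun n => modulus (c n) * r ^+ n)).
Proof.
move=> cs /andP[r0 r1].
pose s := (r + 1) / 2; have s1 : s < 1 by rewrite /s; lra.
have rs : r < s by rewrite /s; lra.
have s0 : 0 < s by apply: le_lt_trans rs.
have [|M cM] := cs s; first by rewrite s0.
apply: (@series_le_cvg _ _ (fun n => M * (r / s) ^+ n)).
- by move=> n; rewrite mulr_ge0 ?modulus_ge0// exprn_ge0.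
- move=> n; apply: mulr_ge0; last by rewrite exprn_ge0// divr_ge0// ltW.
  by apply: le_trans (cM 0%N); rewrite mulr_ge0 ?modulus_ge0.
- move=> n; rewrite expr_div_n mulrA ler_pdivlMr ?exprn_gt0// mulrAC.
  by rewrite ler_wpM2r// exprn_ge0.
- apply: is_cvg_geometric_series.
  by rewrite ger0_norm ?ltr_pdivrMr ?mul1r// divr_ge0// ltW.
Qed.

(** The series converges at the real point s of the disk, so its terms there tend to 0 and are
    bounded. *)
Lemma has_coefs_subexponential f c : has_coefs f c -> subexponential c.
Proof.
move=> fc s /andP[s0 s1].
have ms : modulus s%:C%C < 1 by rewrite modulus_real gtr0_norm.
have := fc (mkdisk ms); set u := fun n => _ => cu.
have u0 : tends \oo u 0.
  rewrite (_ : u = fun n => series u n.+1 - series u n); last first.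
    by apply/funext => n; rewrite /series /= big_nat_recr //= [RHS]addrC addKr.
  rewrite -(subrr (f (mkdisk ms))); apply: cvgcB => //.
  move: cu; rewrite -(tends_shiftn 1) => cu.
  by apply: (eq_tends _ cu) => n; rewrite addn1.
have /cvgcP mu0 := u0.
have /cvg_seq_bounded : cvgn (fun n => modulus (u n - 0)).
  by apply/cvg_ex; exists 0; apply: mu0.
case=> N [Nr HN]; exists (`|N| + 1) => n.
have /= := HN (`|N| + 1) _ n I.
rewrite subr0 (ger0_norm (modulus_ge0 _)) /u modulusM modulusX modulus_real.
rewrite (gtr0_norm s0); apply.
by rewrite (le_lt_trans (ler_norm _))// ltrDl.
Qed.

Lemma coefs_abs_cvg f c (r : R) : has_coefs f c -> 0 <= r < 1 ->
  cvgn (series (fun n => modulus (c n) * r ^+ n)).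
Proof. by move=> /has_coefs_subexponential; exact: subexponential_cvg. Qed.

Lemma coefs_exists c : subexponential c -> exists f, has_coefs f c.
Proof.
move=> cc.
have ex (z : disk R) : exists l : R[i],
    tends \oo (series (fun n => c n * coord z ^+ n)) l.
  have [||l Hl _] := @cvgc_series_dominated R (fun n => c n * coord z ^+ n)
     (fun n => modulus (c n) * modulus (coord z) ^+ n).
  - by move=> n; rewrite modulusM modulusX.
  - by apply: subexponential_cvg => //; rewrite modulus_ge0 disk_modulus.
  - by exists l.
have [f Hf] := choice ex.
by exists f.
Qed.

(** This confines to the circle the accumulation points of a sequence along which an analytic
    function is unbounded. *)
Lemma has_coefs_bounded f c (r : R) : has_coefs f c -> 0 <= r < 1 ->
  exists2 M, 0 <= M & forall z : disk R, modulus (coord z) <= r -> modulus (f z) <= M.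
Proof.
move=> fc r01; have cc := coefs_abs_cvg fc r01; have /andP[r0 _] := r01.
have u0 n : 0 <= modulus (c n) * r ^+ n.
  by rewrite mulr_ge0 ?modulus_ge0// exprn_ge0.
exists (limn (series (fun n => modulus (c n) * r ^+ n))).
  by apply: limr_ge => //; apply: nearW => n; apply: sumr_ge0.
move=> z zr.
have [|//|l Hl lb] := @cvgc_series_dominated R (fun n => c n * coord z ^+ n)
     (fun n => modulus (c n) * r ^+ n).
- move=> n; rewrite modulusM modulusX ler_wpM2l ?modulus_ge0//.
  by rewrite lerXn2r ?nnegrE ?modulus_ge0.
- by rewrite (cvgc_unique (fc z) Hl).
Qed.

Lemma has_coefsD f g c d : has_coefs f c -> has_coefs g d ->
  has_coefs (fun z => f z + g z) (fun n => c n + d n).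
Proof.
move=> fc gd z; apply: (eq_tends _ (cvgcD (fc z) (gd z))) => n.
by rewrite /series /= -big_split /=; apply: eq_bigr => i _; rewrite mulrDl.
Qed.

Lemma has_coefsM f g c d : has_coefs f c -> has_coefs g d ->
  has_coefs (fun z => f z * g z)
    (fun n => \sum_(0 <= j < n.+1) c j * d (n - j)%N).
Proof.
move=> fc gd z; have zb : 0 <= modulus (coord z) < 1.
  by rewrite modulus_ge0 disk_modulus.
have cu : cvgn (series (fun n => modulus (c n * coord z ^+ n))).
  under eq_fun do rewrite modulusM modulusX.
  exact: coefs_abs_cvg fc zb.
have cv : cvgn (series (fun n => modulus (d n * coord z ^+ n))).
  under eq_fun do rewrite modulusM modulusX.
  exact: coefs_abs_cvg gd zb.
apply: (eq_tends _ (cvgc_cauchy_product cu cv (fc z) (gd z))) => n.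
rewrite /series /=.
apply: eq_bigr => i _; rewrite mulr_suml; apply: eq_big_nat => j /andP[_ ji].
rewrite mulrACA -exprD subnKC//.
Qed.

Lemma has_coefs_poly (p : {poly R[i]}) :
  has_coefs (poly_on_disk p) (fun n => p`_n).
Proof.
move=> z; apply: tends_near_cst; near=> n.
have pn : (size p <= n)%N by near: n; exact: nbhs_infty_ge.
rewrite /series poly_on_diskE horner_coef /= (big_cat_nat _ pn) //=.
rewrite [X in _ + X]big_nat [X in _ + X]big1 ?addr0 ?big_mkord// => i /andP[pi _].
by rewrite nth_default ?mul0r.
Unshelve. all: by end_near. Qed.

Lemma subexponential_shift c N : subexponential c ->
  subexponential (fun n => c (n + N)%N).
Proof.
move=> cs s s01; have [M cM] := cs s s01; have /andP[s0 s1] := s01.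
exists (M / s ^+ N) => n.
by rewrite ler_pdivlMr ?exprn_gt0// -mulrA -exprD cM.
Qed.

(** Here g is the N-th backward shift of f: the first N Taylor terms are removed and the rest is
    divided by z^N. *)
Lemma has_coefs_shift f c N : has_coefs f c ->
  exists2 g, has_coefs g (fun n => c (n + N)%N) &
    forall z : disk R, f z = coord z ^+ N * g z + (\poly_(i < N) c i).[coord z].
Proof.
move=> fc.
have [g gc] := coefs_exists (subexponential_shift N (has_coefs_subexponential fc)).
exists g => // z; apply: (cvgc_unique (fc z)).
rewrite -(tends_shiftn N).
have cq : tends \oo (fun _ : nat => (\poly_(i < N) c i).[coord z])
   (\poly_(i < N) c i).[coord z] by exact: cvgc_cst.
have cz : tends \oo (fun _ : nat => coord z ^+ N) (coord z ^+ N) by exact: cvgc_cst.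
apply: (eq_tends _ (cvgcD (cvgcM cz (gc z)) cq)) => n.
rewrite /series /= horner_poly (big_cat_nat (leq0n N) (leq_addl n N)) /= addrC.
rewrite -(big_mkord xpredT (fun i => c i * coord z ^+ i)); congr (_ + _).
have -> : \sum_(N <= i < n + N) c i * coord z ^+ i =
          \sum_(0 + N <= i < n + N) c i * coord z ^+ i by rewrite add0n.
rewrite big_addn addnK mulr_sumr; apply: eq_bigr => i _.
by rewrite exprD mulrCA; congr (_ * _); exact: mulrC.
Qed.

End PowerSeries.

(** * Integrals over the circle *)

Section CircleMean.
Variable R : realType.
Local Notation mu := (@lebesgue_measure R).
Local Notation A := (angles R).
Implicit Types (F G : R -> R[i]).

Lemma measurable_angles : measurable A.
Proof. exact: measurable_itv. Qed.
Hint Resolve measurable_angles : core.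

Lemma measure_angles : mu A = (pi *+ 2)%:E.
Proof.
rewrite /angles lebesgue_measure_itv /= lte_fin gtrN ?pi_gt0//.
by rewrite -EFinB opprK mulr2n.
Qed.

Lemma angles_lty : (mu A < +oo)%E.
Proof. by rewrite measure_angles ltry. Qed.

Lemma twopi_gt0 : 0 < pi *+ 2 :> R.
Proof. by rewrite mulrn_wgt0 ?pi_gt0. Qed.

Lemma twopi_neq0 : pi *+ 2 != 0 :> R.
Proof. by rewrite gt_eqF ?twopi_gt0. Qed.

Lemma aeS (P Q : R -> Prop) : (forall t, P t -> Q t) ->
  {ae mu, forall t, P t} -> {ae mu, forall t, Q t}.
Proof. by move=> PQ; apply: (@filterS _ _ (ae_filter_ringOfSetsType mu)). Qed.

Lemma aeI (P Q : R -> Prop) : {ae mu, forall t, P t} ->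
  {ae mu, forall t, Q t} -> {ae mu, forall t, P t /\ Q t}.
Proof. exact: (@filterI _ _ (ae_filter_ringOfSetsType mu)). Qed.

(** Convergence is only almost everywhere, so Fatou's lemma is applied to the limit inferior, which
    is measurable in any case and agrees with f off a null set. *)
Lemma fatou_bound (f_ : nat -> R -> R) (f : R -> R) (M : R) :
  (forall n, measurable_fun A (f_ n)) -> (forall n t, 0 <= f_ n t) ->
  measurable_fun A f -> (forall t, 0 <= f t) ->
  {ae mu, forall t, A t -> f_ n t @[n --> \oo] --> f t} ->
  (forall n, (\int[mu]_(t in A) (f_ n t)%:E <= M%:E)%E) ->
  (\int[mu]_(t in A) (f t)%:E <= M%:E)%E.
Proof.
move=> mf_ f_0 mf f0 cf fM.
have mfE n : measurable_fun A (fun t => (f_ n t)%:E) by apply/measurable_EFinP.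
pose g t := limn_einf (fun n => (f_ n t)%:E).
have mg : measurable_fun A g.
  apply: measurableT_comp => //; apply: measurable_fun_limn_esup => n.
  exact: measurableT_comp.
apply: le_trans (_ : \int[mu]_(t in A) g t <= _)%E; last first.
  apply: (le_trans (fatou mu measurable_angles mfE _)).
    by move=> n t _; rewrite lee_fin.
  rewrite limn_einf_lim; apply: lime_le; first exact: is_cvg_einfs.
  apply: nearW => n; apply: (le_trans _ (fM n)).
  by apply: ereal_inf_lbound; exists n => //=.
have g_eq t : f_ n t @[n --> \oo] --> f t -> g t = (f t)%:E.
  move=> ft; have : (f_ n t)%:E @[n --> \oo] --> (f t)%:E by apply: cvg_EFin => //; exact: nearW.
  by rewrite /g => /cvg_limn_einf_sup[-> _].
apply: ae_ge0_le_integral => //.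
- by move=> t _; rewrite lee_fin.
- exact/measurable_EFinP.
- move=> t _; rewrite /g limn_einf_lim; apply: lime_ge; first exact: is_cvg_einfs.
  apply: nearW => n; apply: le_ereal_inf_tmp => _ [m _ <-].
  by rewrite lee_fin.
- by apply: aeS cf => t ft /ft/g_eq ->.
Qed.

Lemma is_derive_mull (j t : R) : is_derive t 1 ( *%R j) j.
Proof.
have := is_deriveZ j (is_derive_id t (1 : R)).
by rewrite /GRing.scale /= mulr1.
Qed.

Lemma is_derive_cmull (f : R -> R) (a k t : R) : is_derive t 1 f a ->
  is_derive t 1 (fun x => k * f x) (k * a).
Proof. exact: is_deriveZ. Qed.

Lemma is_derive_sinM (j t : R) :
  is_derive t 1 (fun x => sin (j * x)) (cos (j * t) * j).
Proof. exact: (is_derive1_comp (is_derive_sin _) (is_derive_mull j t)). Qed.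

Lemma is_derive_cosM (j t : R) :
  is_derive t 1 (fun x => cos (j * x)) (- sin (j * t) * j).
Proof. exact: (is_derive1_comp (is_derive_cos _) (is_derive_mull j t)). Qed.

Lemma continuous_mull (j : R) : continuous ( *%R j).
Proof. by move=> x; apply: cvgM; [exact: cvg_cst|exact: cvg_id]. Qed.

Lemma continuous_cosM (j : R) : continuous (fun t => cos (j * t)).
Proof.
move=> x; apply: continuous_comp; [exact: continuous_mull|exact: continuous_cos].
Qed.

Lemma continuous_sinM (j : R) : continuous (fun t => sin (j * t)).
Proof.
move=> x; apply: continuous_comp; [exact: continuous_mull|exact: continuous_sin].
Qed.

Lemma integral_FTC2 (f F : R -> R) : continuous f ->
  (forall t : R, is_derive t 1 F (f t)) ->
  (\int[mu]_(t in A) (f t)%:E = (F pi)%:E - (F (- pi))%:E)%E.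
Proof.
move=> cf dF.
have cF : continuous F.
  by move=> t; apply/differentiable_continuous/derivable1_diffP.
apply: continuous_FTC2; first by rewrite gtrN ?pi_gt0.
- exact: continuous_subspaceT.
- split; first by move=> t _.
  + exact/cvg_at_right_filter/cF.
  + exact/cvg_at_left_filter/cF.
- by move=> t _; rewrite derive1E; apply: derive_val.
Qed.

Lemma sin_natpi n : sin (n%:R * pi) = 0 :> R.
Proof.
elim: n => [|n IH]; first by rewrite mul0r sin0.
by rewrite -natr1 mulrDl mul1r sinDpi IH oppr0.
Qed.

Lemma integral_cosM (n : nat) : n != 0%N ->
  (\int[mu]_(t in A) (cos (n%:R * t))%:E = 0)%E.
Proof.
move=> n0; have nr : n%:R != 0 :> R by rewrite pnatr_eq0.
have dF (t : R) : is_derive t 1 (fun t => n%:R^-1 * sin (n%:R * t)) (cos (n%:R * t)).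
  have := is_derive_cmull n%:R^-1 (is_derive_sinM n%:R t).
  by rewrite mulrCA mulVf ?mulr1.
rewrite (integral_FTC2 (@continuous_cosM _) dF).
by rewrite mulrN sinN sin_natpi oppr0 !mulr0 subee.
Qed.

Lemma integral_sinM (n : nat) : n != 0%N ->
  (\int[mu]_(t in A) (sin (n%:R * t))%:E = 0)%E.
Proof.
move=> n0; have nr : n%:R != 0 :> R by rewrite pnatr_eq0.
have dF (t : R) : is_derive t 1 (fun t => - n%:R^-1 * cos (n%:R * t)) (sin (n%:R * t)).
  have := is_derive_cmull (- n%:R^-1) (is_derive_cosM n%:R t).
  by rewrite mulrCA (mulNr n%:R^-1) mulVf// mulrNN mulr1.
rewrite (integral_FTC2 (@continuous_sinM _) dF).
by rewrite mulrN cosN subee.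
Qed.

End CircleMean.

Section CircleIntegral.
Variable R : realType.
Local Notation mu := (@lebesgue_measure R).
Local Notation A := (angles R).
Implicit Types (F G : R -> R[i]).

Definition cmeas F := measurable_fun A (fun t => complex.Re (F t)) /\
  measurable_fun A (fun t => complex.Im (F t)).

Definition cintg F := mu.-integrable A (fun t => (complex.Re (F t))%:E) /\
  mu.-integrable A (fun t => (complex.Im (F t))%:E).

Lemma cmeasD F G : cmeas F -> cmeas G -> cmeas (fun t => F t + G t).
Proof.
move=> [fr fi] [gr gi]; split.
  by under eq_fun do rewrite ReD; exact: measurable_funD.
by under eq_fun do rewrite ImD; exact: measurable_funD.
Qed.

Lemma cmeasN F : cmeas F -> cmeas (fun t => - F t).
Proof.
move=> [fr fi]; split.
  by under eq_fun do rewrite ReN; exact: measurable_funN.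
by under eq_fun do rewrite ImN; exact: measurable_funN.
Qed.

Lemma cmeasB F G : cmeas F -> cmeas G -> cmeas (fun t => F t - G t).
Proof. by move=> fm gm; apply: cmeasD => //; exact: cmeasN. Qed.

Lemma cmeasM F G : cmeas F -> cmeas G -> cmeas (fun t => F t * G t).
Proof.
move=> [fr fi] [gr gi]; split.
  under eq_fun do rewrite ReM.
  by apply: measurable_funB; exact: measurable_funM.
under eq_fun do rewrite ImM.
by apply: measurable_funD; exact: measurable_funM.
Qed.

Lemma cmeas_conj F : cmeas F -> cmeas (fun t => conjc (F t)).
Proof.
move=> [fr fi]; split.
  rewrite (_ : (fun _ => _) = fun t => complex.Re (F t)) //.
  by apply/funext => t; case: (F t).
rewrite (_ : (fun _ => _) = fun t => - complex.Im (F t)).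
  exact: measurable_funN.
by apply/funext => t; case: (F t).
Qed.

Lemma cmeas_cst (a : R[i]) : cmeas (fun=> a).
Proof. by split; exact: measurable_cst. Qed.

Lemma cmeas_sum (I : Type) (s : seq I) (F : I -> R -> R[i]) :
  (forall i, cmeas (F i)) -> cmeas (fun t => \sum_(i <- s) F i t).
Proof.
move=> mF; elim: s => [|i s IH].
  by under eq_fun do rewrite big_nil; exact: cmeas_cst.
by under eq_fun do rewrite big_cons; exact: cmeasD.
Qed.

Lemma cmeasX F n : cmeas F -> cmeas (fun t => F t ^+ n).
Proof.
move=> mF; elim: n => [|n IH]; first exact: cmeas_cst.
by under eq_fun do rewrite exprS; exact: cmeasM.
Qed.

Lemma cmeas_cvg (F_ : nat -> R -> R[i]) F : (forall n, cmeas (F_ n)) ->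
  (forall t, A t -> tends \oo (fun n => F_ n t) (F t)) -> cmeas F.
Proof.
move=> mF cF; split.
  apply: (measurable_fun_cvg (fun n => (mF n).1)) => t At.
  exact: cvgc_Re (cF t At).
apply: (measurable_fun_cvg (fun n => (mF n).2)) => t At.
exact: cvgc_Im (cF t At).
Qed.

Lemma measurable_modulus_sqr F : cmeas F ->
  measurable_fun A (fun t => modulus (F t) ^+ 2).
Proof.
move=> [fr fi]; under eq_fun do rewrite modulus_sqr.
by apply: measurable_funD; exact: measurable_funX.
Qed.

Lemma L2_cmeas F : L2 F -> cmeas F. Proof. by case. Qed.

Lemma integrable_dominated (f g : R -> R) : measurable_fun A f ->
  mu.-integrable A (fun t => (g t)%:E) -> (forall t, A t -> `|f t| <= g t) ->
  mu.-integrable A (fun t => (f t)%:E).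
Proof.
move=> mf ig fg; apply: (le_integrable _ _ _ ig) => //.
- exact: measurable_angles.
- exact/measurable_EFinP.
- move=> t At; rewrite lee_fin (le_trans (fg t At))//; exact: ler_norm.
Qed.

Lemma cintg_dominated F (g : R -> R) : cmeas F ->
  mu.-integrable A (fun t => (g t)%:E) ->
  (forall t, A t -> modulus (F t) <= g t) -> cintg F.
Proof.
move=> [fr fi] ig Fg; split; apply: (integrable_dominated _ ig) => // t At.
- exact: le_trans (Re_le_modulus _) (Fg t At).
- exact: le_trans (Im_le_modulus _) (Fg t At).
Qed.

Lemma integrable_cst_angles (M : R) : mu.-integrable A (fun=> M%:E).
Proof.
apply: measurable_bounded_integrable => //; first exact: measurable_angles.
  exact: angles_lty.
exists `|M|; split; first by rewrite num_real.
by move=> x Mx t _; rewrite /= ltW.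
Qed.

Lemma cintg_bounded F M : cmeas F -> (forall t, modulus (F t) <= M) -> cintg F.
Proof.
move=> mF FM; apply: (cintg_dominated mF (integrable_cst_angles M)) => t _.
exact: FM.
Qed.

Lemma L2_integrable F : L2 F ->
  mu.-integrable A (fun t => (modulus (F t) ^+ 2)%:E).
Proof.
move=> [fr fi fl]; apply/integrableP; split.
  have mF : cmeas F by split.
  by apply/measurable_EFinP; exact: measurable_modulus_sqr.
by under eq_integral do rewrite gee0_abs ?lee_fin ?sqr_ge0//.
Qed.

(** The circle has finite measure, and |F| <= 1 + |F|^2. *)
Lemma L2_mul_bounded F G M : L2 F -> cmeas G -> (forall t, modulus (G t) <= M) ->
  cintg (fun t => F t * G t).
Proof.
move=> lF mG GM; have mF := L2_cmeas lF.
apply: (@cintg_dominated _ (fun t => M + M * modulus (F t) ^+ 2)).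
- exact: cmeasM.
- under eq_fun do rewrite EFinD EFinM.
  apply: integrableD; first exact: measurable_angles.
    exact: integrable_cst_angles.
  apply: integrableZl; first exact: measurable_angles.
  exact: L2_integrable.
move=> t _; rewrite modulusM mulrC -[X in X + _]mulr1 -mulrDr.
have M0 : 0 <= M by apply: le_trans (GM 0); exact: modulus_ge0.
apply: ler_pM; rewrite ?modulus_ge0//.
by have := sqr_ge0 (modulus (F t) - 2^-1); have := sqr_ge0 (modulus (F t)); nra.
Qed.

Lemma cintgD F G : cintg F -> cintg G -> cintg (fun t => F t + G t).
Proof.
move=> [fr fi] [gr gi]; split.
  under eq_fun do rewrite ReD EFinD.
  by apply: integrableD => //; exact: measurable_angles.
under eq_fun do rewrite ImD EFinD.
by apply: integrableD => //; exact: measurable_angles.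
Qed.

Lemma cintgZ (a : R[i]) F : cintg F -> cintg (fun t => a * F t).
Proof.
move=> [fr fi]; have mA := @measurable_angles R; split.
  under eq_fun do rewrite ReM EFinB !EFinM.
  by apply: integrableB => //; apply: integrableZl.
under eq_fun do rewrite ImM EFinD !EFinM.
by apply: integrableD => //; apply: integrableZl.
Qed.

Lemma cintgN F : cintg F -> cintg (fun t => - F t).
Proof.
by move=> iF; under eq_fun do rewrite -mulN1r; exact: cintgZ.
Qed.

Lemma cintg_sum (I : Type) (s : seq I) (F : I -> R -> R[i]) :
  (forall i, cintg (F i)) -> cintg (fun t => \sum_(i <- s) F i t).
Proof.
move=> iF; elim: s => [|i s IH].
  under eq_fun do rewrite big_nil; apply: (@cintg_bounded _ 0).
    exact: cmeas_cst.
  by move=> t; rewrite modulus0.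
by under eq_fun do rewrite big_cons; exact: cintgD.
Qed.

Lemma circle_meanD F G : cintg F -> cintg G ->
  circle_mean (fun t => F t + G t) = circle_mean F + circle_mean G.
Proof.
move=> [fr fi] [gr gi]; have mA := @measurable_angles R.
rewrite /circle_mean; under eq_Rintegral do rewrite ReD.
under [in X in Complex _ X]eq_Rintegral do rewrite ImD.
by rewrite !RintegralD// !mulrDr.
Qed.

Lemma circle_meanZ (a : R[i]) F : cintg F ->
  circle_mean (fun t => a * F t) = a * circle_mean F.
Proof.
move=> [fr fi]; have mA := @measurable_angles R.
have iZ (x : R) (f : R -> R) : mu.-integrable A (fun t => (f t)%:E) ->
    mu.-integrable A (fun t => (x * f t)%:E).
  by move=> ?; under eq_fun do rewrite EFinM; exact: integrableZl.
rewrite /circle_mean; under eq_Rintegral do rewrite ReM.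
under [in X in Complex _ X]eq_Rintegral do rewrite ImM.
rewrite RintegralB ?RintegralD ?RintegralZl//; try exact: iZ.
case: a => x y; apply/eqP; rewrite eq_complex /=.
by apply/andP; split; apply/eqP; ring.
Qed.

Lemma circle_meanN F : cintg F -> circle_mean (fun t => - F t) = - circle_mean F.
Proof.
move=> iF; rewrite -[RHS]mulN1r -circle_meanZ//.
by congr circle_mean; apply/funext => t; rewrite mulN1r.
Qed.

Lemma circle_meanB F G : cintg F -> cintg G ->
  circle_mean (fun t => F t - G t) = circle_mean F - circle_mean G.
Proof. by move=> iF iG; rewrite circle_meanD ?circle_meanN//; exact: cintgN. Qed.

Lemma circle_mean0 : circle_mean (fun=> 0 : R[i]) = 0.
Proof.
rewrite /circle_mean /= Rintegral_cst; last exact: measurable_angles.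
by rewrite mul0r mulr0.
Qed.

Lemma circle_mean_sum (I : Type) (s : seq I) (F : I -> R -> R[i]) :
  (forall i, cintg (F i)) ->
  circle_mean (fun t => \sum_(i <- s) F i t) = \sum_(i <- s) circle_mean (F i).
Proof.
move=> iF; elim: s => [|i s IH].
  by rewrite big_nil -[RHS]circle_mean0; under eq_fun do rewrite big_nil.
rewrite big_cons -IH -circle_meanD//; last exact: cintg_sum.
by under eq_fun do rewrite big_cons.
Qed.

Lemma circle_mean_conj F : cintg F ->
  circle_mean (fun t => conjc (F t)) = conjc (circle_mean F).
Proof.
move=> [fr fi]; rewrite /circle_mean /=; congr Complex.
  by congr (_ * _); apply: eq_Rintegral => t _; case: (F t).
rewrite -mulrN; congr (_ * _).
rewrite -mulN1r -RintegralZl//; last exact: measurable_angles.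
by apply: eq_Rintegral => t _; rewrite mulN1r; case: (F t).
Qed.

Lemma circle_mean_ae F G : cmeas F -> cmeas G ->
  {ae mu, forall t, A t -> F t = G t} -> circle_mean F = circle_mean G.
Proof.
move=> [fr fi] [gr gi] FG; have mA := @measurable_angles R.
rewrite /circle_mean /Rintegral.
congr (Complex (_ * fine _) (_ * fine _)); apply: ae_eq_integral => //;
  try exact/measurable_EFinP.
- by apply: aeS FG => t FG At; rewrite FG.
- by apply: aeS FG => t FG At; rewrite FG.
Qed.

Lemma circle_mean_cst (a : R[i]) : circle_mean (fun=> a) = a.
Proof.
rewrite /circle_mean /= !Rintegral_cst; try exact: measurable_angles.
rewrite [X in fine X](measure_angles R) /= ![_^-1 * _]mulrC !mulfK ?twopi_neq0//.
by case: a.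
Qed.

(** Cruder than the triangle inequality for complex integrals, but it follows from the real one
    applied to each part; the loss is absorbed into the choice of tolerance where it is used. *)
Lemma modulus_circle_mean F : cintg F ->
  modulus (circle_mean F) <=
  (pi *+ 2)^-1 * (\int[mu]_(t in A) `|complex.Re (F t)| +
                  \int[mu]_(t in A) `|complex.Im (F t)|).
Proof.
move=> [fr fi]; have mA := @measurable_angles R.
apply: le_trans (modulus_le_ReIm _) _ => /=.
have p0 : 0 < (pi *+ 2)^-1 :> R by rewrite invr_gt0 twopi_gt0.
rewrite mulrDr !normrM (gtr0_norm p0).
by apply: lerD; apply: ler_wpM2l (ltW p0) _ _ _; exact: le_normr_Rintegral.
Qed.

Definition expi (t : R) : R[i] := Complex (cos t) (sin t).

Lemma modulus_expi t : modulus (expi t) = 1.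
Proof.
apply/eqP; rewrite -(@eqrXn2 _ 2) ?modulus_ge0// modulus_sqr /=.
by rewrite cos2Dsin2 expr1n.
Qed.

Lemma expi_neq0 t : expi t != 0.
Proof. by rewrite -modulus_eq0 modulus_expi oner_eq0. Qed.

Lemma expiD s t : expi (s + t) = expi s * expi t.
Proof.
rewrite /expi cosD sinD; apply/eqP; rewrite eq_complex /=.
by apply/andP; split; apply/eqP; ring.
Qed.

Lemma expiX n t : expi t ^+ n = expi (n%:R * t).
Proof.
elim: n => [|n IH]; first by rewrite mul0r /expi cos0 sin0.
by rewrite exprSr IH -expiD -natr1 mulrDl mul1r.
Qed.

Lemma polarE (r t : R) : polar r t = r%:C%C * expi t.
Proof.
by apply/eqP; rewrite eq_complex /=; apply/andP; split; apply/eqP; ring.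
Qed.

Lemma modulus_polar (r t : R) : modulus (polar r t) = `|r|.
Proof. by rewrite polarE modulusM modulus_expi mulr1 modulus_real. Qed.

Lemma cmeas_expi : cmeas expi.
Proof.
split; apply: measurable_funTS; apply: continuous_measurable_fun.
- exact: continuous_cos.
- exact: continuous_sin.
Qed.

Lemma modulus_expiX n t : modulus (expi t ^+ n) = 1.
Proof. by rewrite modulusX modulus_expi expr1n. Qed.

Lemma cintg_expiX n : cintg (fun t => expi t ^+ n).
Proof.
apply: (@cintg_bounded _ 1); first exact/cmeasX/cmeas_expi.
by move=> t; rewrite modulus_expiX.
Qed.

Lemma circle_mean_expiX n : circle_mean (fun t => expi t ^+ n) = (n == 0)%:R.
Proof.
have [->|n0] := eqVneq n 0; first by rewrite circle_mean_cst.
under eq_fun do rewrite expiX.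
rewrite /circle_mean /Rintegral /= integral_cosM// integral_sinM// /= !mulr0.
by [].
Qed.

Lemma circle_mean_expi_conj n m :
  circle_mean (fun t => expi t ^+ n * conjc (expi t ^+ m)) = (n == m)%:R.
Proof.
have le_case a b : (a <= b)%N ->
    circle_mean (fun t => expi t ^+ b * conjc (expi t ^+ a)) = (a == b)%:R.
  move=> ab; rewrite -(subnK ab).
  transitivity (circle_mean (fun t => expi t ^+ (b - a)%N)).
    congr circle_mean; apply/funext => t.
    by rewrite exprD -mulrA mulc_conj modulus_expiX expr1n mulr1.
  by rewrite circle_mean_expiX -[in RHS](add0n a) eqn_add2r eq_sym.
have [nm|/ltnW mn] := leqP n m; last by rewrite le_case// eq_sym.
rewrite -[LHS]conjcK -circle_mean_conj.
  rewrite -(conjc_nat _ (n == m)) -(le_case _ _ nm); congr (conjc (circle_mean _)).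
  by apply/funext => t; rewrite rmorphM /= conjcK mulrC.
apply: (@cintg_bounded _ 1).
  by apply: cmeasM; [|apply: cmeas_conj]; exact/cmeasX/cmeas_expi.
by move=> t; rewrite modulusM modulus_conj !modulus_expiX mulr1.
Qed.

End CircleIntegral.

(** * Parseval's identity *)

Section Parseval.
Variable R : realType.
Local Notation mu := (@lebesgue_measure R).
Local Notation A := (angles R).
Implicit Types (f g : disk R -> R[i]) (b c d : nat -> R[i]).

Definition trig b K (t : R) : R[i] := \sum_(0 <= n < K) b n * expi t ^+ n.

Lemma cmeas_trig b K : cmeas (trig b K).
Proof.
apply: cmeas_sum => n; apply: cmeasM; first exact: cmeas_cst.
exact/cmeasX/cmeas_expi.
Qed.

Lemma modulus_trig b K t : modulus (trig b K t) <= \sum_(0 <= n < K) modulus (b n).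
Proof.
apply: le_trans (modulus_sum _ _ _) _; apply: ler_sum => n _.
by rewrite modulusM modulus_expiX mulr1.
Qed.

Lemma cintg_mul_expi_conj (F : R -> R[i]) M n : cmeas F ->
  (forall t, modulus (F t) <= M) -> cintg (fun t => F t * conjc (expi t ^+ n)).
Proof.
move=> mF FM; apply: (@cintg_bounded _ _ M).
  by apply: cmeasM => //; exact/cmeas_conj/cmeasX/cmeas_expi.
by move=> t; rewrite modulusM modulus_conj modulus_expiX mulr1.
Qed.

Lemma circle_mean_trig_expi b K n :
  circle_mean (fun t => trig b K t * conjc (expi t ^+ n)) =
  if (n < K)%N then b n else 0.
Proof.
have ie m : cintg (fun t : R => expi t ^+ m * conjc (expi t ^+ n)).
  apply: (@cintg_mul_expi_conj _ 1); first exact/cmeasX/cmeas_expi.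
  by move=> t; rewrite modulus_expiX.
transitivity (circle_mean (fun t =>
    \sum_(0 <= m < K) b m * (expi t ^+ m * conjc (expi t ^+ n)))).
  congr circle_mean; apply/funext => t; rewrite /trig mulr_suml.
  by apply: eq_bigr => m _; rewrite mulrA.
rewrite circle_mean_sum => [|m]; last exact: cintgZ.
under eq_bigr do rewrite circle_meanZ// circle_mean_expi_conj.
case: ifPn => [nK|]; last first.
  rewrite -leqNgt => Kn; rewrite big_nat big1// => m /andP[_ mK].
  by rewrite ltn_eqF ?mulr0// (leq_trans mK).
rewrite (bigD1_seq n) ?mem_index_iota ?iota_uniq//= eqxx mulr1.
by rewrite big1 ?addr0// => m /negbTE ->; rewrite mulr0.
Qed.

Lemma circle_mean_trig_sqr b K :
  circle_mean (fun t => trig b K t * conjc (trig b K t)) =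
  (\sum_(0 <= n < K) modulus (b n) ^+ 2)%:C%C.
Proof.
have ie n : cintg (fun t : R => trig b K t * conjc (expi t ^+ n)).
  exact: cintg_mul_expi_conj (cmeas_trig b K) (modulus_trig b K).
transitivity (circle_mean (fun t =>
    \sum_(0 <= n < K) conjc (b n) * (trig b K t * conjc (expi t ^+ n)))).
  congr circle_mean; apply/funext => t; rewrite {2}/trig rmorph_sum /= mulr_sumr.
  by apply: eq_bigr => m _; rewrite rmorphM mulrCA.
rewrite circle_mean_sum => [|m]; last exact: cintgZ.
rewrite rmorph_sum /= !big_nat; apply: eq_bigr => n /andP[_ nK].
by rewrite circle_meanZ// circle_mean_trig_expi nK mulrC mulc_conj.
Qed.

Lemma integral_trig_sqr b K :
  (\int[mu]_(t in A) (modulus (trig b K t) ^+ 2)%:E =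
   (pi *+ 2 * \sum_(0 <= n < K) modulus (b n) ^+ 2)%:E)%E.
Proof.
have := congr1 (@complex.Re R) (circle_mean_trig_sqr b K).
rewrite /circle_mean /=; under eq_Rintegral do rewrite mulc_conj /=.
move=> <-; rewrite mulVKf ?twopi_neq0// /Rintegral fineK//.
apply: integrable_fin_num; first exact: measurable_angles.
apply: (integrable_dominated _
  (integrable_cst_angles ((\sum_(0 <= n < K) modulus (b n)) ^+ 2))).
  apply: measurable_modulus_sqr; exact: cmeas_trig.
move=> t _; rewrite ger0_norm ?sqr_ge0// lerXn2r ?nnegrE ?modulus_ge0//.
  by apply: sumr_ge0 => n _; exact: modulus_ge0.
exact: modulus_trig.
Qed.

Lemma modulus_polar_lt1 (r t : R) : 0 <= r < 1 -> modulus (polar r t) < 1.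
Proof. by move=> /andP[r0 r1]; rewrite modulus_polar ger0_norm. Qed.

Lemma dilateE f (r t : R) (r01 : 0 <= r < 1) :
  dilate f r t = f (mkdisk (modulus_polar_lt1 t r01)).
Proof.
rewrite /dilate; case: insubP => [z _ zE|].
  by congr f; apply: disk_coord_inj; rewrite coord_mkdisk.
by rewrite norm_lt1 modulus_polar_lt1.
Qed.

Lemma tends_trig f c (r t : R) : has_coefs f c -> 0 <= r < 1 ->
  tends \oo (fun K => trig (fun n => c n * (r ^+ n)%:C%C) K t) (dilate f r t).
Proof.
move=> fc r01; rewrite (dilateE _ _ r01).
apply: (eq_tends _ (fc (mkdisk (modulus_polar_lt1 t r01)))) => K.
rewrite /series /trig; apply: eq_bigr => n _.
by rewrite coord_mkdisk polarE exprMn mulrA rmorphXn.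
Qed.

Lemma cmeas_dilate f c (r : R) : has_coefs f c -> 0 <= r < 1 ->
  cmeas (dilate f r).
Proof.
move=> fc r01; apply: (cmeas_cvg (fun K => cmeas_trig _ K)) => t _.
exact: tends_trig.
Qed.

(** One half of Parseval's identity on the circle of radius r: Fatou's lemma along the partial sums,
    whose coefficients are only diminished by the factors r^n <= 1. *)
Lemma integral_dilate_le f c (r M : R) : has_coefs f c ->
  (forall K, \sum_(0 <= n < K) modulus (c n) ^+ 2 <= M) -> 0 <= r < 1 ->
  (\int[mu]_(t in A) (modulus (dilate f r t) ^+ 2)%:E <= (pi *+ 2 * M)%:E)%E.
Proof.
move=> fc cM r01; have /andP[r0 r1] := r01.
pose b n := c n * (r ^+ n)%:C%C.
apply: (@fatou_bound _ (fun K t => modulus (trig b K t) ^+ 2)).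
- by move=> K; apply: measurable_modulus_sqr; exact: cmeas_trig.
- by move=> K t; exact: sqr_ge0.
- apply: measurable_modulus_sqr; exact: cmeas_dilate fc r01.
- by move=> t; exact: sqr_ge0.
- apply: aeW => t _; have /cvgc_modulus ct := tends_trig (t := t) fc r01.
  by rewrite expr2; under eq_fun do rewrite expr2; exact: cvgM.
move=> K; rewrite integral_trig_sqr lee_fin ler_wpM2l ?(ltW (twopi_gt0 _))//.
apply: le_trans (cM K); apply: ler_sum => n _.
rewrite modulusM modulus_real ger0_norm ?exprn_ge0// exprMn ler_piMr ?sqr_ge0//.
by rewrite exprn_ile1 ?exprn_ge0// exprn_ile1// ltW.
Qed.

(** The other half needs the integrals of the partial sums to converge. For fixed r < 1 these sums
    are dominated by the finite sum of |c_n| r^n, so dominated convergence applies. *)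
Lemma bessel f c (r M : R) K : has_coefs f c -> 0 <= r < 1 ->
  (\int[mu]_(t in A) (modulus (dilate f r t) ^+ 2)%:E <= M%:E)%E ->
  pi *+ 2 * \sum_(0 <= n < K) (modulus (c n) ^+ 2 * r ^+ n ^+ 2) <= M.
Proof.
move=> fc r01 fM; have /andP[r0 r1] := r01.
pose b n := c n * (r ^+ n)%:C%C.
have bE n : modulus (b n) = modulus (c n) * r ^+ n.
  by rewrite modulusM modulus_real ger0_norm ?exprn_ge0.
have cabs := coefs_abs_cvg fc r01.
pose B := limn (series (fun n => modulus (c n) * r ^+ n)).
have bB J t : modulus (trig b J t) <= B.
  apply: le_trans (modulus_trig b J t) _.
  rewrite (eq_bigr _ (fun n _ => bE n)).
  apply: nondecreasing_cvgn_le => //; apply: nneg_series_ndecr => n.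
  by rewrite mulr_ge0 ?modulus_ge0 ?exprn_ge0.
have [|||||_ _ cI] := @dominated_convergence _ _ _ mu A (@measurable_angles R)
  (fun J t => (modulus (trig b J t) ^+ 2)%:E)
  (fun t => (modulus (dilate f r t) ^+ 2)%:E) (fun=> (B ^+ 2)%:E).
- by move=> J; apply/measurable_EFinP; apply: measurable_modulus_sqr; exact: cmeas_trig.
- by apply/measurable_EFinP; apply: measurable_modulus_sqr; exact: cmeas_dilate fc r01.
- apply: aeW => t _; apply: cvg_EFin; first exact: nearW.
  have /cvgc_modulus ct := tends_trig (t := t) fc r01.
  by rewrite expr2 /comp /=; under eq_fun do rewrite expr2; exact: cvgM.
- exact: integrable_cst_angles.
- apply: aeW => t J _; rewrite gee0_abs ?lee_fin ?sqr_ge0//.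
  by rewrite lerXn2r ?nnegrE ?modulus_ge0// (le_trans (modulus_ge0 _) (bB J t)).
rewrite -lee_fin; apply: (le_trans _ fM).
rewrite -(cvg_lim _ cI)//; apply: lime_ge; first by apply/cvg_ex; eexists; exact: cI.
near=> J; have KJ : (K <= J)%N by near: J; exact: nbhs_infty_ge.
rewrite /= integral_trig_sqr lee_fin ler_wpM2l ?(ltW (twopi_gt0 _))//.
rewrite (big_cat_nat (leq0n K) KJ) /= -[leLHS]addr0 lerD//.
  by apply: ler_sum => n _; rewrite bE exprMn.
by apply: sumr_ge0 => n _; exact: sqr_ge0.
Unshelve. all: by end_near. Qed.

(** A sequence of radii, since the convergence theorems for integrals are sequential; its distance
    to 1 is the harmonic sequence. *)
Definition radius (m : nat) : R := 1 - m.+1%:R^-1.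

Lemma radius01 m : 0 <= radius m < 1.
Proof.
rewrite /radius subr_ge0 invf_le1 ?ltr0n// ler1n /= ltrBlDr ltrDl invr_gt0.
by rewrite ltr0n.
Qed.

Lemma cvg_radius : radius @ \oo --> (1 : R).
Proof.
rewrite -[X in _ --> X](subr0 1); apply: cvgB; first exact: cvg_cst.
exact: cvg_harmonic.
Qed.

Lemma tends_radius (F : R -> R[i]) z :
  tends (1 : R)^'- F z -> tends \oo (fun m => F (radius m)) z.
Proof.
have rl : radius @ \oo --> (1 : R)^'-.
  move=> P P1; have P2 : nbhs (1 : R) (fun u => u < 1 -> P u) by exact: P1.
  have : \forall m \near \oo, radius m < 1 -> P (radius m) by exact: cvg_radius P2.
  by apply: filterS => m /=; apply; case/andP: (radius01 m).
by move=> Fz; exact: (cvg_comp _ _ rl Fz).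
Qed.

(** For fixed K, r tends to 1 in [bessel]. Together with [H2_of_coefs] this turns the integral
    definition of H^2 into square-summability of the coefficients. *)
Lemma H2_coefs_bounded f c : has_coefs f c -> H2 f ->
  exists M, forall K, \sum_(0 <= n < K) modulus (c n) ^+ 2 <= M.
Proof.
move=> fc [_ [M fM]]; exists ((pi *+ 2)^-1 * M) => K.
rewrite -ler_pdivrMl ?invr_gt0 ?twopi_gt0// invrK.
have ck : (fun m => pi *+ 2 * \sum_(0 <= n < K)
      (modulus (c n) ^+ 2 * radius m ^+ n ^+ 2)) @ \oo -->
    pi *+ 2 * \sum_(0 <= n < K) (modulus (c n) ^+ 2 * 1 ^+ n ^+ 2).
  apply: cvgM; first exact: cvg_cst.
  apply: cvg_big => [|n _]; first exact: add_continuous.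
  apply: cvgM; first exact: cvg_cst.
  have rn : radius m ^+ n @[m --> \oo] --> (1 : R) ^+ n.
    exact: (cvg_comp _ _ cvg_radius (@exprn_continuous R n 1)).
  by rewrite [X in _ --> X]expr2; under eq_fun do rewrite expr2; exact: cvgM.
rewrite (_ : \sum_(0 <= n < K) modulus (c n) ^+ 2 =
  \sum_(0 <= n < K) (modulus (c n) ^+ 2 * 1 ^+ n ^+ 2)); last first.
  by apply: eq_bigr => n _; rewrite !expr1n mulr1.
rewrite -(cvg_lim (@Rhausdorff R) ck); apply: limr_le.
  by apply/cvg_ex; eexists; exact: ck.
by apply: nearW => m; apply: (bessel _ fc (radius01 m)); apply: fM; exact: radius01.
Qed.

Lemma H2_of_coefs f c M : has_coefs f c ->
  (forall K, \sum_(0 <= n < K) modulus (c n) ^+ 2 <= M) -> H2 f.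
Proof.
move=> fc cM; split; first by exists c.
by exists (pi *+ 2 * M) => r r01; exact: integral_dilate_le fc cM r01.
Qed.

Lemma analytic_coefs f : analytic f -> exists c, has_coefs f c.
Proof. by []. Qed.

(** Fatou's lemma along [radius]: a radial limit inherits its L2 bound from the coefficients. *)
Lemma fatou_L2 f c M (F : R -> R[i]) : has_coefs f c ->
  (forall K, \sum_(0 <= n < K) modulus (c n) ^+ 2 <= M) -> cmeas F ->
  {ae mu, forall t, A t -> tends (1 : R)^'- (fun r => dilate f r t) (F t)} ->
  (\int[mu]_(t in A) (modulus (F t) ^+ 2)%:E <= (pi *+ 2 * M)%:E)%E.
Proof.
move=> fc cM mF lF.
apply: (@fatou_bound _ (fun m t => modulus (dilate f (radius m) t) ^+ 2)).
- by move=> m; apply: measurable_modulus_sqr; exact: cmeas_dilate fc (radius01 m).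
- by move=> m t; exact: sqr_ge0.
- exact: measurable_modulus_sqr.
- by move=> t; exact: sqr_ge0.
- apply: aeS lF => t Ft At; have /cvgc_modulus ct := tends_radius (Ft At).
  by rewrite expr2; under eq_fun do rewrite expr2; exact: cvgM.
by move=> m; apply: (integral_dilate_le fc cM); exact: radius01.
Qed.

End Parseval.

(** * Boundary values and Fourier coefficients *)

Section BoundaryValues.
Variable R : realType.
Local Notation mu := (@lebesgue_measure R).
Local Notation A := (angles R).
Implicit Types (f g : disk R -> R[i]) (c d : nat -> R[i]) (F G : R -> R[i]).

Lemma dilateD f g (r t : R) :
  dilate (fun z => f z + g z) r t = dilate f r t + dilate g r t.
Proof. by rewrite /dilate; case: insub => [z|] //=; rewrite addr0. Qed.

Lemma dilateB f g (r t : R) :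
  dilate (fun z => f z - g z) r t = dilate f r t - dilate g r t.
Proof. by rewrite /dilate; case: insub => [z|] //=; rewrite subr0. Qed.

Lemma dilateM f g (r t : R) :
  dilate (fun z => f z * g z) r t = dilate f r t * dilate g r t.
Proof. by rewrite /dilate; case: insub => [z|] //=; rewrite mulr0. Qed.

Lemma has_coefsB f g c d : has_coefs f c -> has_coefs g d ->
  has_coefs (fun z => f z - g z) (fun n => c n - d n).
Proof.
move=> fc gd z; apply: (eq_tends _ (cvgcB (fc z) (gd z))) => n.
by rewrite /series /= -sumrB; apply: eq_bigr => i _; rewrite mulrBl.
Qed.

Lemma near_left1 : \forall r \near (1 : R)^'-, 0 <= r < 1.
Proof.
near=> r; apply/andP; split; last by near: r; exact: nbhs_left_lt.
by apply/ltW; near: r; apply: nbhs_left_gt; exact: ltr01.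
Unshelve. all: by end_near. Qed.

Lemma tends_near_eq (T : Type) (Fi : set_system T) {FF : Filter Fi}
  (f g : T -> R[i]) z :
  (\forall t \near Fi, f t = g t) -> tends Fi f z -> tends Fi g z.
Proof.
move=> fg; apply: cvg_trans; apply: (@near_eq_cvg _ R[i]^o).
by apply: filterS fg => t ->.
Qed.

Lemma tends_horner (T : Type) (Fi : set_system T) {FF : ProperFilter Fi}
  (p : {poly R[i]}) (f : T -> R[i]) z :
  tends Fi f z -> tends Fi (fun t => p.[f t]) p.[z].
Proof.
move=> fz; elim/poly_ind: p => [|p a IH].
  by rewrite horner0; under eq_fun do rewrite horner0; exact: cvgc_cst.
rewrite !hornerE; under eq_fun do rewrite !hornerE.
by apply: cvgcD; [exact: cvgcM|exact: cvgc_cst].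
Qed.

Lemma tends_polar (t : R) : tends (1 : R)^'- (fun r => polar r t) (expi t).
Proof.
apply: (@cvgc_le0 _ _ _ _ _ _ (fun r => `|1 - r|)).
  apply: nearW => r; rewrite polarE -{2}[expi t]mul1r -mulrBl modulusM.
  rewrite modulus_expi mulr1 (_ : r%:C%C - 1 = (r - 1)%:C%C); last first.
    by rewrite rmorphB.
  by rewrite modulus_real distrC.
rewrite -[X in _ --> X](normr0 R) -(subrr (1 : R)).
apply: cvg_norm; apply: cvgB; first exact: cvg_cst.
exact: cvg_at_left_filter.
Qed.

Lemma dilate_poly (p : {poly R[i]}) (r t : R) : 0 <= r < 1 ->
  dilate (poly_on_disk p) r t = p.[polar r t].
Proof. by move=> r01; rewrite (dilateE _ _ r01). Qed.

Lemma tends_dilate_poly (p : {poly R[i]}) (t : R) :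
  tends (1 : R)^'- (fun r => dilate (poly_on_disk p) r t) p.[expi t].
Proof.
have H : tends (1 : R)^'- (fun r => p.[polar r t]) p.[expi t].
  by apply: tends_horner; exact: tends_polar.
apply: (tends_near_eq _ H); apply: filterS near_left1 => r r01.
by rewrite dilate_poly.
Qed.

Lemma modulus_horner (p : {poly R[i]}) z : modulus z <= 1 ->
  modulus p.[z] <= \sum_(i < size p) modulus p`_i.
Proof.
move=> z1; rewrite horner_coef; apply: le_trans (modulus_sum _ _ _) _.
apply: ler_sum => i _; rewrite modulusM modulusX ler_piMr ?modulus_ge0//.
by rewrite exprn_ile1 ?modulus_ge0.
Qed.

Lemma cmeas_poly (p : {poly R[i]}) : cmeas (fun t : R => p.[expi t]).
Proof.
under eq_fun do rewrite horner_coef.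
apply: cmeas_sum => i; apply: cmeasM; first exact: cmeas_cst.
exact/cmeasX/cmeas_expi.
Qed.

Lemma Hinfty_poly (p : {poly R[i]}) : Hinfty (poly_on_disk p).
Proof.
split; first by exists (fun n => p`_n); exact: has_coefs_poly.
exists (\sum_(i < size p) modulus p`_i) => z.
by apply: modulus_horner; exact/ltW/disk_modulus.
Qed.

Lemma analyticM f g : analytic f -> analytic g -> analytic (fun z => f z * g z).
Proof.
by move=> [c fc] [d gd]; eexists; exact: (has_coefsM fc gd).
Qed.

Lemma Hinfty_ge0 f : Hinfty f ->
  analytic f /\ exists2 M : R, 0 <= M & forall z, modulus (f z) <= M.
Proof.
move=> [fa [M fM]]; split=> //; exists `|M| => // z.
exact: le_trans (fM z) (ler_norm _).
Qed.

Lemma H2_mul_bounded f g : Hinfty f -> H2 g -> H2 (fun z => f z * g z).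
Proof.
move=> /Hinfty_ge0[fa [M M0 fM]] [ga [N gN]]; split; first exact: analyticM.
have [d gd] := analytic_coefs ga.
exists (M ^+ 2 * N) => r r01.
have mg : measurable_fun A (fun t => modulus (dilate g r t) ^+ 2).
  apply: measurable_modulus_sqr; exact: cmeas_dilate gd r01.
have [e fge] := analytic_coefs (analyticM fa ga).
apply: le_trans (_ : \int[mu]_(t in A) ((M ^+ 2)%:E *
    (modulus (dilate g r t) ^+ 2)%:E) <= _)%E; last first.
  rewrite ge0_integralZl_EFin//; last 4 first.
  - exact: measurable_angles.
  - by move=> t _; rewrite lee_fin sqr_ge0.
  - exact/measurable_EFinP.
  - exact: sqr_ge0.
  rewrite [(M ^+ 2 * N)%:E]EFinM.
  apply: lee_wpmul2l; first by rewrite lee_fin sqr_ge0.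
  exact: gN.
apply: ge0_le_integral => //.
- exact: measurable_angles.
- by move=> t _; rewrite lee_fin sqr_ge0.
- apply/measurable_EFinP; apply: measurable_modulus_sqr.
  exact: cmeas_dilate fge r01.
- by apply: measurable_funeM; exact/measurable_EFinP.
- move=> t _; rewrite -EFinM lee_fin dilateM modulusM exprMn.
  apply: ler_wpM2r; first exact: sqr_ge0.
  rewrite lerXn2r ?nnegrE ?modulus_ge0//.
  by rewrite (dilateE _ _ r01).
Qed.

Lemma H2D f g : H2 f -> H2 g -> H2 (fun z => f z + g z).
Proof.
move=> Hf Hg; have [c fc] := analytic_coefs Hf.1.
have [d gd] := analytic_coefs Hg.1.
have [M cM] := H2_coefs_bounded fc Hf; have [N dN] := H2_coefs_bounded gd Hg.
apply: (@H2_of_coefs _ _ _ (2 * M + 2 * N) (has_coefsD fc gd)) => K.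
apply: le_trans (_ : 2 * \sum_(0 <= n < K) modulus (c n) ^+ 2 +
                     2 * \sum_(0 <= n < K) modulus (d n) ^+ 2 <= _).
  rewrite !mulr_sumr -big_split /=; apply: ler_sum => n _.
  have := le_modulusD (c n) (d n).
  have := modulus_ge0 (c n); have := modulus_ge0 (d n).
  have := modulus_ge0 (c n + d n).
  move: (modulus (c n + d n)) (modulus (c n)) (modulus (d n)) => x y w x0 w0 y0 xyw.
  apply: le_trans (_ : (y + w) ^+ 2 <= _); first by rewrite lerXn2r ?nnegrE ?addr_ge0.
  by have := sqr_ge0 (y - w); nra.
by apply: lerD; rewrite ler_wpM2l.
Qed.

Lemma H2_poly (p : {poly R[i]}) : H2 (poly_on_disk p).
Proof.
have H1 : H2 (poly_on_disk (1 : {poly R[i]})).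
  apply: (@H2_of_coefs R _ _ 1 (@has_coefs_poly R 1)) => -[|K].
    by rewrite big_geq.
  rewrite big_nat_recl// big1 ?addr0 => [|i _]; rewrite coef1.
    by rewrite eqxx modulus1 expr1n.
  by rewrite mulr0n modulus0 expr0n.
have := H2_mul_bounded (Hinfty_poly p) H1.
by under eq_fun do rewrite (poly_on_diskE 1) hornerC mulr1.
Qed.

Lemma H2B f g : H2 f -> H2 g -> H2 (fun z => f z - g z).
Proof.
move=> Hf Hg; apply: H2D => //.
have := H2_mul_bounded (Hinfty_poly (- 1)) Hg.
by under eq_fun do rewrite (poly_on_diskE (-1)) hornerN hornerC mulN1r.
Qed.

Definition radial_limit f F :=
  {ae mu, forall t, A t -> tends (1 : R)^'- (fun r => dilate f r t) (F t)}.

(** Square-integrability comes from [fatou_L2], so an explicit candidate has to be checked only for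
    measurability and radial limits. *)
Lemma boundary_mk f F : H2 f -> cmeas F -> radial_limit f F -> boundary_value f F.
Proof.
move=> Hf mF lF; split=> //; have [c fc] := analytic_coefs Hf.1.
have [M cM] := H2_coefs_bounded fc Hf.
split; [exact: mF.1|exact: mF.2|].
by apply: le_lt_trans (fatou_L2 fc cM mF lF) _; rewrite ltry.
Qed.

Lemma boundary_L2 f F : boundary_value f F -> L2 F. Proof. by case. Qed.
Lemma boundary_cmeas f F : boundary_value f F -> cmeas F.
Proof. by case=> -[]. Qed.
Lemma boundary_radial f F : boundary_value f F -> radial_limit f F.
Proof. by case. Qed.

Lemma boundary_unique f F G : boundary_value f F -> boundary_value f G ->
  {ae mu, forall t, A t -> F t = G t}.
Proof.
move=> [_ fF] [_ fG]; apply: aeS (aeI fF fG) => t [Ft Gt] At.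
exact: cvgc_unique (Ft At) (Gt At).
Qed.

Lemma boundaryD f g F G : H2 f -> H2 g -> boundary_value f F ->
  boundary_value g G -> boundary_value (fun z => f z + g z) (fun t => F t + G t).
Proof.
move=> Hf Hg bF bG; apply: boundary_mk; first exact: H2D.
  by apply: cmeasD; [exact: boundary_cmeas bF|exact: boundary_cmeas bG].
apply: aeS (aeI bF.2 bG.2) => t [Ft Gt] At.
apply: (eq_tends _ (cvgcD (Ft At) (Gt At))) => r.
by rewrite dilateD.
Qed.

Lemma boundaryB f g F G : H2 f -> H2 g -> boundary_value f F ->
  boundary_value g G -> boundary_value (fun z => f z - g z) (fun t => F t - G t).
Proof.
move=> Hf Hg bF bG; apply: boundary_mk; first exact: H2B.
  by apply: cmeasB; [exact: boundary_cmeas bF|exact: boundary_cmeas bG].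
apply: aeS (aeI bF.2 bG.2) => t [Ft Gt] At.
apply: (eq_tends _ (cvgcB (Ft At) (Gt At))) => r.
by rewrite dilateB.
Qed.

Lemma boundaryM f g F G : H2 (fun z => f z * g z) -> boundary_value f F ->
  boundary_value g G -> boundary_value (fun z => f z * g z) (fun t => F t * G t).
Proof.
move=> Hfg bF bG; apply: boundary_mk => //.
  by apply: cmeasM; [exact: boundary_cmeas bF|exact: boundary_cmeas bG].
apply: aeS (aeI bF.2 bG.2) => t [Ft Gt] At.
apply: (eq_tends _ (cvgcM (Ft At) (Gt At))) => r.
by rewrite dilateM.
Qed.

Lemma boundary_poly (p : {poly R[i]}) :
  boundary_value (poly_on_disk p) (fun t => p.[expi t]).
Proof.
apply: boundary_mk; [exact: H2_poly|exact: cmeas_poly|].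
by apply: aeW => t _; exact: tends_dilate_poly.
Qed.

Lemma nneg_tail (u : nat -> R) M (e : R) : (forall n, 0 <= u n) ->
  (forall K, \sum_(0 <= n < K) u n <= M) -> 0 < e ->
  exists K0, forall K L, (K0 <= K)%N -> \sum_(K <= n < L) u n <= e.
Proof.
move=> u0 uM e0.
have cu : cvgn (series u).
  apply: nondecreasing_is_cvgn; first exact: nneg_series_ndecr.
  by exists M => _ [K _ <-]; exact: uM.
have /cvgrPdist_lt /(_ _ e0) [K0 _ HK0] := cu.
exists K0 => K L K0K; have [LK|/ltnW KL] := leqP L K; first by rewrite big_geq// ltW.
have hK := HK0 K K0K; rewrite /= in hK.
have lL : series u L <= limn (series u).
  by apply: nondecreasing_cvgn_le => //; exact: nneg_series_ndecr.
have lK := ler_norm (limn (series u) - series u K).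
have sE : series u L = series u K + \sum_(K <= n < L) u n.
  by rewrite /series /= (big_cat_nat (leq0n K) KL).
by lra.
Qed.

Lemma has_coefs_tail f c K : has_coefs f c ->
  has_coefs (fun z => f z - poly_on_disk (\poly_(i < K) c i) z)
    (fun n => if (n < K)%N then 0 else c n).
Proof.
move=> fc; set p := \poly_(i < K) c i.
rewrite (_ : (fun n => _) = fun n => c n - p`_n).
  exact: has_coefsB fc (@has_coefs_poly R p).
by apply/funext => n; rewrite coef_poly; case: ifP; rewrite ?subrr ?subr0.
Qed.

Lemma tail_sqr_le c (e : R) K :
  (forall L, \sum_(K <= n < L) modulus (c n) ^+ 2 <= e) ->
  forall L, \sum_(0 <= n < L) modulus (if (n < K)%N then 0 else c n) ^+ 2 <= e.
Proof.
move=> ce L; have [LK|/ltnW KL] := leqP L K.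
  rewrite big_nat big1 => [|n /andP[_ nL]].
    by have := ce K; rewrite big_geq.
  by rewrite (leq_trans nL LK) modulus0 expr0n.
rewrite (big_cat_nat (leq0n K) KL) /= big_nat big1 ?add0r => [|n /andP[_ ->]];
  last by rewrite modulus0 expr0n.
apply: le_trans (ce L); rewrite !big_nat; apply: ler_sum => n /andP[Kn _].
by rewrite ltnNge Kn.
Qed.

(** A substitute for the Cauchy-Schwarz inequality: when the integral of x^2 is of order d^2, that
    of x is of order d. *)
Lemma sqr_dominates_linear (x d : R) : 0 < d -> x <= d + d^-1 * x ^+ 2.
Proof.
move=> d0; rewrite -(ler_pM2l d0) mulrDr mulrA divff ?gt_eqF// mul1r.
by have := sqr_ge0 (x - d); nra.
Qed.

Lemma integrableZ_EFin (k : R) (h : R -> R) :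
  mu.-integrable A (fun t => (h t)%:E) -> mu.-integrable A (fun t => (k * h t)%:E).
Proof.
move=> ih; under eq_fun do rewrite EFinM.
by apply: integrableZl => //; exact: measurable_angles.
Qed.

Lemma integrableD_EFin (g h : R -> R) :
  mu.-integrable A (fun t => (g t)%:E) -> mu.-integrable A (fun t => (h t)%:E) ->
  mu.-integrable A (fun t => (g t + h t)%:E).
Proof.
move=> ig ih; under eq_fun do rewrite EFinD.
by apply: integrableD => //; exact: measurable_angles.
Qed.

Lemma RintegralZl_angles (k : R) (h : R -> R) :
  mu.-integrable A (fun t => (h t)%:E) ->
  \int[mu]_(t in A) (k * h t) = k * \int[mu]_(t in A) h t.
Proof. by move=> ih; rewrite RintegralZl//; exact: measurable_angles. Qed.

(* Fatou's lemma bounds the L2 distance of F to the n-th partial sum of its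
   Fourier series by the tail of the coefficients. *)
Lemma circle_mean_boundary f c F (E : R -> R[i]) (a : R[i]) K0 :
  has_coefs f c -> H2 f -> boundary_value f F -> cmeas E ->
  (forall t, modulus (E t) <= 1) ->
  (forall K, (K0 <= K)%N -> circle_mean (fun t => trig c K t * E t) = a) ->
  circle_mean (fun t => F t * E t) = a.
Proof.
move=> fc Hf bF mE E1 Ea; have [M cM] := H2_coefs_bounded fc Hf.
apply/eqP; rewrite -subr_eq0 -modulus_eq0; apply/eqP/le_anti.
rewrite modulus_ge0 andbT; apply/ler_addgt0Pr => d d0; rewrite add0r.
(* The real and the imaginary part will each contribute at most 2 e. *)
pose e := d / 4; have e0 : 0 < e by rewrite /e; lra.
have e20 : 0 < e ^+ 2 by rewrite exprn_gt0.
have [K1 tail] := nneg_tail (fun n => sqr_ge0 (modulus (c n))) cM e20.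
pose K := maxn K0 K1.
pose p := \poly_(i < K) c i.
pose G t := F t - p.[expi t].
have pE t : p.[expi t] = trig c K t.
  by rewrite horner_poly /trig big_mkord.
have bG : boundary_value (fun z => f z - poly_on_disk p z) G.
  exact: (boundaryB Hf (H2_poly p) bF (boundary_poly p)).
have gc := has_coefs_tail (K := K) fc.
have gM := tail_sqr_le (fun L => tail K L (leq_maxr _ _)).
have mG := boundary_cmeas bG.
have iG2 := L2_integrable (boundary_L2 bG).
have G2 : \int[mu]_(t in A) (modulus (G t) ^+ 2) <= pi *+ 2 * e ^+ 2.
  rewrite -lee_fin /Rintegral fineK; last first.
    by apply: integrable_fin_num => //; exact: measurable_angles.
  exact: fatou_L2 gc gM mG (boundary_radial bG).
have iGE : cintg (fun t => G t * E t).
  exact: (L2_mul_bounded (boundary_L2 bG) mE E1).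
have itE : cintg (fun t => trig c K t * E t).
  apply: (@cintg_bounded _ _ (\sum_(0 <= n < K) modulus (c n))).
    by apply: cmeasM => //; exact: cmeas_trig.
  move=> t; rewrite modulusM -[leRHS]mulr1.
  by apply: ler_pM; rewrite ?modulus_ge0// modulus_trig.
(* As K >= K0, the partial sum contributes exactly a, and only the tail G remains to be
   estimated. *)
have <- : circle_mean (fun t => G t * E t) = circle_mean (fun t => F t * E t) - a.
  rewrite -(Ea K (leq_maxl _ _)) -circle_meanB//; last first.
    exact: (L2_mul_bounded (boundary_L2 bF) mE E1).
  by congr circle_mean; apply/funext => t; rewrite /G pE mulrBl.
have iD : mu.-integrable A (fun t => (e + e^-1 * modulus (G t) ^+ 2)%:E).
  by apply: integrableD_EFin; [exact: integrable_cst_angles|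
                                exact: integrableZ_EFin].
have GEe t : modulus (G t * E t) <= e + e^-1 * modulus (G t) ^+ 2.
  apply: le_trans (sqr_dominates_linear _ e0).
  by rewrite modulusM ler_piMr ?modulus_ge0.
have intD : \int[mu]_(t in A) (e + e^-1 * modulus (G t) ^+ 2) <= pi *+ 2 * (2 * e).
  rewrite RintegralD//; last 3 first.
  - exact: measurable_angles.
  - exact: integrable_cst_angles.
  - exact: integrableZ_EFin.
  rewrite (RintegralZl_angles _ iG2).
  rewrite Rintegral_cst; last exact: measurable_angles.
  rewrite [X in fine X](measure_angles R) /= -lerBrDl mulrC ler_pdivrMr//.
  apply: le_trans G2 _; rewrite le_eqVlt; apply/orP; left; apply/eqP; ring.
apply: le_trans (modulus_circle_mean iGE) _.
rewrite ler_pdivrMl ?twopi_gt0//.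
have -> : pi *+ 2 * d = pi *+ 2 * (2 * e) + pi *+ 2 * (2 * e).
  by rewrite /e; field.
have mA := @measurable_angles R.
have iN (h : R -> R) : mu.-integrable A (fun t => (h t)%:E) ->
    mu.-integrable A (fun t => `|h t|%:E) by move=> ih; exact: (integrable_abse ih).
apply: lerD; apply: le_trans intD; apply: le_Rintegral => //.
- exact: iN iGE.1.
- by move=> t _; exact: le_trans (Re_le_modulus _) (GEe t).
- exact: iN iGE.2.
- by move=> t _; exact: le_trans (Im_le_modulus _) (GEe t).
Qed.

Lemma fourier_coef f c F n : has_coefs f c -> H2 f -> boundary_value f F ->
  circle_mean (fun t => F t * conjc (expi t ^+ n)) = c n.
Proof.
move=> fc Hf bF; apply: (circle_mean_boundary (K0 := n.+1) fc Hf bF).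
- exact/cmeas_conj/cmeasX/cmeas_expi.
- by move=> t; rewrite modulus_conj modulus_expiX.
- by move=> K nK; rewrite circle_mean_trig_expi nK.
Qed.

Lemma fourier_coef_neg f F n : H2 f -> boundary_value f F ->
  circle_mean (fun t => F t * expi t ^+ n.+1) = 0.
Proof.
move=> Hf bF; have [c fc] := analytic_coefs Hf.1.
apply: (circle_mean_boundary (K0 := 0) fc Hf bF).
- exact/cmeasX/cmeas_expi.
- by move=> t; rewrite modulus_expiX.
move=> K _.
transitivity (circle_mean (fun t =>
    \sum_(0 <= m < K) c m * expi t ^+ (m + n.+1)%N : R[i])).
  congr circle_mean; apply/funext => t; rewrite /trig mulr_suml.
  by apply: eq_bigr => m _; rewrite exprD mulrA.
rewrite circle_mean_sum => [|m]; last exact/cintgZ/cintg_expiX.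
rewrite big1// => m _; rewrite circle_meanZ; last exact: cintg_expiX.
by rewrite circle_mean_expiX addnS mulr0.
Qed.

End BoundaryValues.

(** * The range space of a co-analytic Toeplitz operator *)

Section RangeSpace.
Variable R : realType.
Local Notation mu := (@lebesgue_measure R).
Local Notation A := (angles R).
Implicit Types (f g h : disk R -> R[i]) (c d : nat -> R[i]) (F G : R -> R[i]).

(* Carrying the boundary value along makes Fatou's theorem on the existence of
   radial limits unnecessary. *)
Definition H2b f := H2 f /\ exists F, boundary_value f F.

Lemma H2bD f g : H2b f -> H2b g -> H2b (fun z => f z + g z).
Proof.
move=> [Hf [F bF]] [Hg [G bG]]; split; first exact: H2D.
by exists (fun t => F t + G t); exact: boundaryD.
Qed.

Lemma H2bM f g : Hinfty f -> H2b f -> H2b g -> H2b (fun z => f z * g z).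
Proof.
move=> bf [Hf [F bF]] [Hg [G bG]]; have Hfg := H2_mul_bounded bf Hg.
by split=> //; exists (fun t => F t * G t); exact: boundaryM.
Qed.

Lemma H2b_poly (p : {poly R[i]}) : H2b (poly_on_disk p).
Proof.
by split; [exact: H2_poly|exists (fun t => p.[expi t]); exact: boundary_poly].
Qed.

Lemma H2b_polyM (p : {poly R[i]}) f : H2b f -> H2b (fun z => p.[coord z] * f z).
Proof. exact: H2bM (Hinfty_poly p) (H2b_poly p). Qed.

Lemma tendsV (T : Type) (Fi : set_system T) {FF : ProperFilter Fi}
  (f : T -> R[i]) z : z != 0 -> tends Fi f z -> tends Fi (fun t => (f t)^-1) z^-1.
Proof. by move=> z0; exact: (@cvgV R[i] T Fi FF f z z0). Qed.

(** The boundary value of the shift is explicit, (F - p) e^(-iNt) with p the first N Taylor terms,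
    so the shift stays in [H2b]. *)
Lemma H2b_shift f c N : has_coefs f c -> H2b f ->
  exists h, has_coefs h (fun n => c (n + N)%N) /\ H2b h.
Proof.
move=> fc [Hf [F bF]]; have [h hc fh] := has_coefs_shift N fc.
have [M cM] := H2_coefs_bounded fc Hf.
have Hh : H2 h.
  apply: (H2_of_coefs (M := M) hc) => K; apply: le_trans (cM (K + N)%N).
  rewrite (big_cat_nat (leq0n N) (leq_addl K N)) /=.
  have -> : \sum_(N <= n < K + N) modulus (c n) ^+ 2 =
            \sum_(0 + N <= n < K + N) modulus (c n) ^+ 2 by rewrite add0n.
  rewrite big_addn addnK lerDr.
  by apply: sumr_ge0 => n _; exact: sqr_ge0.
exists h; split => //; split => //.
set p := \poly_(i < N) c i in fh.
exists (fun t => (F t - p.[expi t]) * (expi t ^+ N)^-1); apply: boundary_mk => //.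
  apply: cmeasM; first exact: cmeasB (boundary_cmeas bF) (cmeas_poly p).
  under eq_fun do rewrite -conjc_inv_modulus ?modulus_expiX//.
  exact/cmeas_conj/cmeasX/cmeas_expi.
apply: aeS (boundary_radial bF) => t Ft At.
have tq : tends (1 : R)^'-
    (fun r => (dilate f r t - dilate (poly_on_disk p) r t) * (polar r t ^+ N)^-1)
    ((F t - p.[expi t]) * (expi t ^+ N)^-1).
  apply: cvgcM; first by apply: cvgcB (Ft At) _; exact: tends_dilate_poly.
  apply: tendsV; first by rewrite expf_neq0// expi_neq0.
  have tp : tends (1 : R)^'- (fun r => ('X^N : {poly R[i]}).[polar r t]) 'X^N.[expi t].
    by apply: tends_horner; exact: tends_polar.
  by rewrite hornerXn in tp; apply: (eq_tends _ tp) => r; rewrite hornerXn.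
apply: (tends_near_eq _ tq); near=> r.
have r01 : 0 <= r < 1 by near: r; exact: near_left1.
(* Division by z^N requires z != 0, which holds for r near 1. *)
have r0 : 0 < r by near: r; apply: nbhs_left_gt; exact: ltr01.
have pn0 : polar r t ^+ N != 0.
  by rewrite expf_neq0// -modulus_eq0 modulus_polar normr_eq0 gt_eqF.
rewrite !(dilateE _ _ r01) fh coord_mkdisk poly_on_diskE coord_mkdisk addrK.
by rewrite mulrC mulrA mulVf// mul1r.
Unshelve. all: by end_near. Qed.

(** For |e| = |x| = 1, conj (e - x) = 1/e - 1/x = - x^-1 (e - x) e^-1. The constant c is the product
    of the - x^-1 over the roots x. *)
Lemma circle_rooted_conj (a : {poly R[i]}) : circle_rooted a ->
  exists2 c, c != 0 & forall e, modulus e = 1 ->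
    conjc a.[e] = c * (a.[e] * conjc (e ^+ (size a).-1)).
Proof.
move=> [s s1 ->]; rewrite size_prod_XsubC /=.
elim: s s1 => [|x s IH] s1.
  exists 1; first by rewrite oner_eq0.
  by move=> e e1; rewrite big_nil hornerC expr0 conjc1 !mulr1.
have [c c0 cE] := IH (fun y ys => s1 y (mem_behead (s := x :: s) ys)).
have x1 : modulus x = 1.
  apply: complexI; rewrite -normcE_modulus; apply: s1; exact: mem_head.
have x0 : x != 0 by rewrite -modulus_eq0 x1 oner_eq0.
exists (- x^-1 * c); first by rewrite mulf_neq0// oppr_eq0 invr_eq0.
move=> e e1; have e0 : e != 0 by rewrite -modulus_eq0 e1 oner_eq0.
rewrite big_cons hornerM rmorphM /= cE// hornerXsubC rmorphB /=.
rewrite !conjc_inv_modulus// ?modulusX ?e1 ?expr1n//.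
rewrite exprS invfM; field.
by rewrite expf_neq0// e0 x0.
Qed.

Lemma circle_rooted_monic (a : {poly R[i]}) : circle_rooted a -> a \is monic.
Proof. by move=> [s _ ->]; exact: monic_prod_XsubC. Qed.

Lemma has_coefs_inj f g c : has_coefs f c -> has_coefs g c -> f =1 g.
Proof. by move=> fc gc z; exact: cvgc_unique (fc z) (gc z). Qed.

Lemma has_coefs_finite f c N : has_coefs f c ->
  (forall n, (N <= n)%N -> c n = 0) -> exists p : {poly R[i]}, f =1 poly_on_disk p.
Proof.
move=> fc cN; exists (\poly_(i < N) c i); apply: (has_coefs_inj fc).
have cE : (fun n => (\poly_(i < N) c i)`_n) = c.
  by apply/funext => n; rewrite coef_poly; case: ltnP => // /cN.
by have := @has_coefs_poly R (\poly_(i < N) c i); rewrite cE.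
Qed.

Lemma H2_circle_expi n : H2_circle (fun t : R => expi t ^+ n).
Proof.
exists (poly_on_disk 'X^n); first exact: H2_poly.
rewrite (_ : (fun t => _) = fun t => 'X^n.[expi t]); first exact: boundary_poly.
by apply/funext => t; rewrite hornerXn.
Qed.

(* On the circle conj a = k z^-N a, hence T_(conj a) f = k S*^N (a f) for the
   backward shift S*. *)
Lemma range_space_split (a : {poly R[i]}) g : circle_rooted a ->
  range_space (poly_on_disk a) g ->
  exists h (p : {poly R[i]}), H2b h /\ forall z, g z = a.[coord z] * h z + p.[coord z].
Proof.
move=> ha [f [Hf Hg [A0 [F [G [bA bF bG [_ orth]]]]]]].
have [k k0 kE] := circle_rooted_conj ha.
set N := (size a).-1 in kE.
have [c fc] := analytic_coefs Hf.1; have [d gd] := analytic_coefs Hg.1.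
have Haf := H2_mul_bounded (Hinfty_poly a) Hf.
have bAF := boundaryM Haf (boundary_poly a) bF.
pose e n := \sum_(0 <= j < n.+1) a`_j * c (n - j)%N.
have afc : has_coefs (fun z => poly_on_disk a z * f z) e.
  exact: has_coefsM (@has_coefs_poly R a) fc.
(* Orthogonality tested on e^(int) identifies the n-th Taylor coefficient of g with k times the (n +
   N)-th coefficient of a f. *)
have dE n : d n = k * e (n + N)%N.
  have := orth _ (H2_circle_expi n).
  pose D t := k * (a.[expi t] * F t * conjc (expi t ^+ (n + N))) -
              G t * conjc (expi t ^+ n).
  have mexp m : cmeas (fun t : R => conjc (expi t ^+ m)).
    exact/cmeas_conj/cmeasX/cmeas_expi.
  have bexp m (t : R) : modulus (conjc (expi t ^+ m)) <= 1.
    by rewrite modulus_conj modulus_expiX.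
  have iAF := L2_mul_bounded (boundary_L2 bAF) (mexp (n + N)%N) (bexp _).
  have iG := L2_mul_bounded (boundary_L2 bG) (mexp n) (bexp _).
  rewrite /inner (@circle_mean_ae _ _ D); last 3 first.
  - apply: cmeasM (mexp n); apply: cmeasB (boundary_cmeas bG).
    by apply: cmeasM (boundary_cmeas bF); apply: cmeas_conj (boundary_cmeas bA).
  - apply: cmeasB; last exact: cmeasM (boundary_cmeas bG) (mexp n).
    apply: cmeasM; first exact: cmeas_cst.
    exact: cmeasM (boundary_cmeas bAF) (mexp _).
  - apply: aeS (boundary_unique bA (boundary_poly a)) => t Aa At.
    rewrite Aa// kE ?modulus_expi// /D mulrBl exprD rmorphM /=.
    by congr (_ - _); ring.
  rewrite /D circle_meanB ?circle_meanZ//; last exact: cintgZ.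
  rewrite (fourier_coef _ afc Haf bAF) (fourier_coef _ gd Hg bG) => /eqP.
  by rewrite subr_eq0 => /eqP.
have [h [hc Hh]] := H2b_shift N fc (conj Hf (ex_intro _ F bF)).
have kac := has_coefsM (@has_coefs_poly R (k *: a)) hc.
have [|p up] := has_coefs_finite (has_coefsB gd kac) (N := N).
  move=> n Nn; rewrite dE /e mulr_sumr; apply/eqP; rewrite subr_eq0; apply/eqP.
  have nN : (n.+1 <= (n + N).+1)%N by rewrite ltnS leq_addr.
  rewrite (big_cat_nat (leq0n _) nN) /= [X in _ + X]big_nat [X in _ + X]big1.
    rewrite addr0 !big_nat; apply: eq_bigr => j /andP[_ jn].
    by rewrite coefZ mulrA addnBAC.
  move=> j /andP[nj _]; rewrite nth_default ?mul0r ?mulr0//.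
  apply: leq_trans nj; rewrite -(leq_add2r 1) addn1 -addn1.
  by rewrite addn1 addn1 ltnS; apply: leq_trans (leqSpred _) _; rewrite ltnS.
exists (fun z => (k%:P).[coord z] * h z), p; split; first exact: H2b_polyM.
move=> z; rewrite hornerC -[p.[_]]/(poly_on_disk p z) -up.
rewrite (poly_on_diskE (k *: a)) hornerZ mulrCA mulrA addrCA subrr addr0//.
Qed.

(* With z^N p = u a + v and deg v < N, the preimage is f = (z^N h + u) / k. *)
Lemma range_space_of_split (a p : {poly R[i]}) g h : circle_rooted a ->
  H2b h -> (forall z, g z = a.[coord z] * h z + p.[coord z]) ->
  range_space (poly_on_disk a) g.
Proof.
move=> ha Hh gE; have [k k0 kE] := circle_rooted_conj ha.
set N := (size a).-1 in kE.
have am := circle_rooted_monic ha.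
have a0 : a != 0 by exact: monic_neq0.
set u := ('X^N * p) %/ a; set v := ('X^N * p) %% a.
have uv : 'X^N * p = u * a + v by exact: divp_eq.
have sv : (size v <= N)%N.
  by rewrite -ltnS /N prednK ?size_poly_gt0// ltn_modp.
pose f z : R[i] := (k^-1%:P).[coord z] * (('X^N).[coord z] * h z + u.[coord z]).
have [Hh2 [Hb bH]] := Hh.
have Hf : H2b f by apply: H2b_polyM; apply: H2bD (H2b_poly u); exact: H2b_polyM.
pose G t := a.[expi t] * Hb t + p.[expi t].
have H2ah := H2_mul_bounded (Hinfty_poly a) Hh2.
have -> : g = fun z => poly_on_disk a z * h z + poly_on_disk p z.
  by apply/funext => z; rewrite gE.
have Hg := H2D H2ah (H2_poly p).
have bG := boundaryD H2ah (H2_poly p) (boundaryM H2ah (boundary_poly a) bH)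
  (boundary_poly p).
pose XH t : R[i] := ('X^N).[expi t] * Hb t + u.[expi t].
have H2xh := H2_mul_bounded (Hinfty_poly 'X^N) Hh2.
have bX := boundaryD H2xh (H2_poly u) (boundaryM H2xh (boundary_poly 'X^N) bH)
  (boundary_poly u).
have bF := boundaryM Hf.1 (boundary_poly k^-1%:P) bX.
exists f; split => //; first exact: Hf.1.
exists (fun t => a.[expi t]), (fun t => (k^-1%:P).[expi t] * XH t), G.
split; [exact: boundary_poly|exact: bF|exact: bG|].
split; first by exists (fun z => poly_on_disk a z * h z + poly_on_disk p z);
  [exact: Hg|exact: bG].
move=> H [w Hw bW]; rewrite /inner.
(* On the circle the error is - v z^-N. Since deg v < N it has only negative frequencies, and is
   therefore orthogonal to H^2. *)
have dE t : conjc a.[expi t] * ((k^-1%:P).[expi t] * XH t) - G t =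
    - (v.[expi t] * conjc (expi t ^+ N)).
  rewrite kE ?modulus_expi// /XH /G hornerC conjc_inv_modulus ?modulus_expiX//.
  have uvt := congr1 (fun q : {poly R[i]} => q.[expi t]) uv.
  rewrite /= !hornerE in uvt.
  have x0 : expi t ^+ N != 0 by rewrite expf_neq0// expi_neq0.
  have vt : v.[expi t] = expi t ^+ N * p.[expi t] - u.[expi t] * a.[expi t].
    by rewrite uvt addrAC subrr add0r.
  by rewrite vt hornerXn; field; rewrite x0 k0.
(* The conjugate of the integrand. Its frequencies N - j are positive, and are written as successors
   to match [fourier_coef_neg]. *)
pose q : R -> R[i] := fun t => \sum_(j < N) (- conjc v`_j) * (H t * expi t ^+ (N - j.+1).+1).
have iq m : cintg (fun t => H t * expi t ^+ m).
  apply: (@L2_mul_bounded _ _ _ 1 (boundary_L2 bW)).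
    exact/cmeasX/cmeas_expi.
  by move=> t; rewrite modulus_expiX.
have -> : (fun t => (conjc a.[expi t] * ((k^-1%:P).[expi t] * XH t) - G t) * conjc (H t)) =
    (fun t => conjc (q t)).
  apply/funext => t; rewrite dE /q rmorph_sum (horner_coef_wide _ sv).
  rewrite mulr_suml -sumrN mulr_suml; apply: eq_bigr => j _.
  rewrite !rmorphM rmorphN /= conjcK.
  rewrite subnSK//.
  have -> : expi t ^+ N = expi t ^+ (N - j) * expi t ^+ j.
    by rewrite -exprD subnK// ltnW.
  rewrite rmorphM /=.
  rewrite [conjc (expi t ^+ j)]conjc_inv_modulus ?modulus_expiX//.
  by field; rewrite expf_neq0// expi_neq0.
rewrite circle_mean_conj; last by apply: cintg_sum => j; exact: cintgZ.
rewrite circle_mean_sum => [|j]; last exact: cintgZ.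
rewrite big1 ?conjc0// => j _.
by rewrite circle_meanZ// (fourier_coef_neg _ Hw bW) mulr0.
Qed.

End RangeSpace.

(** * Growth at the circle *)

Section Growth.
Variable R : realType.
Implicit Types (f g h : disk R -> R[i]) (c d : nat -> R[i]).

(** G is o(1 / (1 - |z|)) uniformly as |z| tends to 1. A simple pole at a point of the circle
    violates this along the radius to that point. *)
Definition tame (G : disk R -> R[i]) := forall e : R, 0 < e ->
  exists2 d : R, 0 < d & forall z, 1 - modulus (coord z) < d ->
    (1 - modulus (coord z)) * modulus (G z) <= e.

Lemma one_sub_modulus_gt0 (z : disk R) : 0 < 1 - modulus (coord z).
Proof. by rewrite subr_gt0 disk_modulus. Qed.

Lemma tame_bounded G M : (forall z, modulus (G z) <= M) -> tame G.
Proof.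
move=> GM e e0; have N0 : 0 < `|M| + 1 by rewrite ltr_wpDl.
exists (e / (`|M| + 1)); first by rewrite divr_gt0.
move=> z; rewrite ltr_pdivlMr// => /ltW; apply: le_trans.
rewrite ler_wpM2l ?(ltW (one_sub_modulus_gt0 z))//.
by apply: le_trans (GM z) _; rewrite (le_trans (ler_norm _))// lerDl.
Qed.

Lemma tameD F G : tame F -> tame G -> tame (fun z => F z + G z).
Proof.
move=> tF tG e e0; have e2 : 0 < e / 2 by rewrite divr_gt0.
have [d d0 Fd] := tF _ e2; have [d' d'0 Gd] := tG _ e2.
exists (Num.min d d'); first by rewrite lt_min d0.
move=> z; rewrite lt_min => /andP[zd zd'].
apply: le_trans (_ : (1 - modulus (coord z)) * (modulus (F z) + modulus (G z)) <= _).
  by rewrite ler_wpM2l ?(ltW (one_sub_modulus_gt0 z))// le_modulusD.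
by rewrite mulrDr [leRHS](splitr e) lerD ?Fd ?Gd.
Qed.

Lemma tameM_bounded F G M : (forall z, modulus (F z) <= M) -> tame G ->
  tame (fun z => F z * G z).
Proof.
move=> FM tG e e0; have N0 : 0 < `|M| + 1 by rewrite ltr_wpDl.
have [d d0 Gd] := tG (e / (`|M| + 1)) (divr_gt0 e0 N0).
exists d => // z /Gd; rewrite ler_pdivlMr//; apply: le_trans.
rewrite modulusM [modulus (F z) * _]mulrC mulrA ler_wpM2l//.
  by rewrite mulr_ge0 ?modulus_ge0// ltW ?one_sub_modulus_gt0.
by apply: le_trans (FM z) _; rewrite (le_trans (ler_norm _))// lerDl.
Qed.

Lemma poly_bounded (p : {poly R[i]}) :
  exists M : R, forall z : disk R, modulus p.[coord z] <= M.
Proof. by have [_ [M pM]] := Hinfty_poly p; exists M. Qed.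

Lemma tameM_poly (p : {poly R[i]}) G : tame G -> tame (fun z => p.[coord z] * G z).
Proof. by have [M pM] := poly_bounded p; exact: tameM_bounded pM. Qed.

Lemma tameB F G : tame F -> tame G -> tame (fun z => F z - G z).
Proof.
move=> tF tG; apply: tameD => // e /tG[d d0 Gd]; exists d => // z /Gd.
by rewrite modulusN.
Qed.

Lemma geometric_sum_le (r : R) K : 0 <= r < 1 ->
  (1 - r) * \sum_(0 <= n < K) r ^+ n <= 1.
Proof.
move=> /andP[r0 r1]; elim: K => [|K IH]; first by rewrite big_geq ?mulr0 ?ler01.
have -> : (1 - r) * \sum_(0 <= n < K.+1) r ^+ n =
          1 - r ^+ K.+1.
  elim: {IH} K => [|K IH]; first by rewrite big_nat1 mulr1 expr1.
  by rewrite big_nat_recr //= mulrDr IH !exprS; ring.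
by rewrite gerBl exprn_ge0.
Qed.

(** The Cauchy-Schwarz inequality for the sum of c_n z^n, after weakening r^(2n) to r^n; this is why
    1 - r appears and not 1 - r^2. *)
Lemma H2_growth_le f c M : has_coefs f c -> 0 < M ->
  (forall K, \sum_(0 <= n < K) modulus (c n) ^+ 2 <= M) ->
  forall z, (1 - modulus (coord z)) * modulus (f z) ^+ 2 <= M.
Proof.
move=> fc M0 cM z; set r := modulus (coord z); set y := modulus (f z).
have r1 : 0 < 1 - r by exact: one_sub_modulus_gt0.
have r01 : 0 <= r < 1 by rewrite modulus_ge0 -subr_gt0.
have [y0|y_gt0] := leP y 0.
  have -> : y = 0 by apply/le_anti; rewrite y0 modulus_ge0.
  by rewrite expr0n /= mulr0 ltW.
(* In |c_n| r^n <= l/2 |c_n|^2 + r^n / (2 l), this l makes the first part sum to at most y / 2,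
   which is absorbed into the left-hand side. *)
pose l := y / M; have l0 : 0 < l by rewrite divr_gt0.
have bound K : modulus (series (fun n => c n * coord z ^+ n) K) <=
    (l * M + l^-1 / (1 - r)) / 2.
  apply: le_trans (modulus_sum _ _ _) _.
  apply: le_trans (_ : \sum_(0 <= n < K)
      (l / 2 * modulus (c n) ^+ 2 + l^-1 / 2 * r ^+ n) <= _).
    apply: ler_sum => n _; rewrite modulusM modulusX -/r.
    have rn0 : 0 <= r ^+ n by rewrite exprn_ge0 ?modulus_ge0.
    have rn1 : r ^+ n <= 1 by rewrite exprn_ile1 ?modulus_ge0 ?ltW// -subr_gt0.
    move: (modulus (c n)) (r ^+ n) rn0 rn1 => x w w0 w1.
    rewrite -(ler_pM2l l0).
    have -> : l * (l / 2 * x ^+ 2 + l^-1 / 2 * w) = ((l * x) ^+ 2 + w) / 2.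
      by field; rewrite gt_eqF.
    have := sqr_ge0 (l * x - w); nra.
  rewrite big_split /= -!mulr_sumr mulrDl lerD//.
    by rewrite mulrAC ler_wpM2r// ler_wpM2l ?(ltW l0)// cM.
  rewrite mulrAC ler_wpM2r// ler_wpM2l ?invr_ge0 ?(ltW l0)//.
  by rewrite -[leRHS]div1r ler_pdivlMr// mulrC geometric_sum_le.
have : y <= (l * M + l^-1 / (1 - r)) / 2.
  by apply: cvgc_modulus_le (fc z) _; exact: nearW.
have lM : l * M = y by rewrite /l mulfVK// gt_eqF.
rewrite lM /l invf_div => yb.
have yb2 : y <= M / y / (1 - r) by lra.
move: yb2; rewrite ler_pdivlMr// ler_pdivlMr// => yb3.
by rewrite expr2 mulrA [(1 - r) * y]mulrC.
Qed.

Lemma H2_growth f : H2 f -> exists2 M, 0 < M &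
  forall z, (1 - modulus (coord z)) * modulus (f z) ^+ 2 <= M.
Proof.
move=> Hf; have [c fc] := analytic_coefs Hf.1.
have [M cM] := H2_coefs_bounded fc Hf.
have M0 : 0 < `|M| + 1 by rewrite ltr_wpDl.
exists (`|M| + 1) => //; apply: (H2_growth_le fc M0) => K.
by apply: le_trans (cM K) _; rewrite (le_trans (ler_norm _))// lerDl.
Qed.

Lemma H2_growth_small f : H2 f -> forall e : R, 0 < e ->
  exists2 d : R, 0 < d & forall z, 1 - modulus (coord z) < d ->
    (1 - modulus (coord z)) * modulus (f z) ^+ 2 <= e.
Proof.
move=> Hf e e0; have [c fc] := analytic_coefs Hf.1.
have [M cM] := H2_coefs_bounded fc Hf.
(* In |f|^2 <= 2 |f - p|^2 + 2 |p|^2 each term is to contribute at most e / 2. *)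
have e4 : 0 < e / 4 by rewrite divr_gt0.
have [K tail] := nneg_tail (fun n => sqr_ge0 (modulus (c n))) cM e4.
pose p := \poly_(i < K) c i.
have gc := has_coefs_tail (K := K) fc.
have gM := tail_sqr_le (fun L => tail K L (leqnn K)).
have [B pB] := poly_bounded p; have N0 : 0 < B ^+ 2 + 1 by rewrite ltr_wpDl ?sqr_ge0.
exists (e / 4 / (B ^+ 2 + 1)); first by rewrite divr_gt0.
move=> z; rewrite ltr_pdivlMr// => ze.
have := H2_growth_le gc e4 gM z.
have z0 := one_sub_modulus_gt0 z.
have fp : modulus (f z) <= modulus (f z - poly_on_disk p z) + modulus p.[coord z].
  by rewrite -lerBlDr -[X in modulus X - _](subrK (poly_on_disk p z)) lerBlDr
    le_modulusD.
move: (modulus_ge0 p.[coord z]) (modulus_ge0 (f z - poly_on_disk p z)) (pB z) fp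
  (modulus_ge0 (f z)).
move: (modulus (f z)) (modulus (f z - poly_on_disk p z)) (modulus p.[coord z])
  (1 - modulus (coord z)) z0 ze => x w v s s0 se v0 w0 vB xwv x0 sw.
have vB2 : v ^+ 2 <= B ^+ 2 by rewrite lerXn2r ?nnegrE// (le_trans v0).
have x2 : x ^+ 2 <= 2 * w ^+ 2 + 2 * v ^+ 2.
  apply: le_trans (_ : (w + v) ^+ 2 <= _).
    by rewrite lerXn2r ?nnegrE ?addr_ge0.
  by have := sqr_ge0 (w - v); nra.
have sx : s * x ^+ 2 <= s * (2 * w ^+ 2 + 2 * v ^+ 2) by rewrite ler_wpM2l ?(ltW s0).
have sv : s * v ^+ 2 <= s * B ^+ 2 by rewrite ler_wpM2l ?(ltW s0).
have sB : s * (B ^+ 2 + 1) = s * B ^+ 2 + s by rewrite mulrDr mulr1.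
lra.
Qed.

(** Covers products of two H^2 functions, which need not belong to H^2, by |f g| <= (|f|^2 + |g|^2)
    / 2. *)
Lemma tame_H2M f g : H2 f -> H2 g -> tame (fun z => f z * g z).
Proof.
move=> Hf Hg e e0; have [d d0 fd] := H2_growth_small Hf e0.
have [d' d'0 gd] := H2_growth_small Hg e0.
exists (Num.min d d'); first by rewrite lt_min d0.
move=> z; rewrite lt_min => /andP[/fd + /gd]; rewrite modulusM.
have := one_sub_modulus_gt0 z.
move: (1 - modulus (coord z)) (modulus (f z)) (modulus (g z)) => s x y s0 sx sy.
have : s * (x * y) <= s * ((x ^+ 2 + y ^+ 2) / 2).
  by rewrite ler_wpM2l ?(ltW s0)//; have := sqr_ge0 (x - y); nra.
lra.
Qed.

Lemma tame_H2 f : H2 f -> tame f.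
Proof.
move=> Hf; have := tame_H2M Hf (H2_poly 1).
by under eq_fun do rewrite (poly_on_diskE 1) hornerC mulr1.
Qed.

(** * Radial approach to a point of the circle, and division by its linear factor *)

Lemma modulus_radial (x : R[i]) m : modulus x = 1 ->
  modulus ((radius R m)%:C%C * x) < 1.
Proof.
by move=> x1; have /andP[r0 r1] := radius01 R m; rewrite modulusM modulus_real x1
  mulr1 ger0_norm.
Qed.

Definition radial_point (x : R[i]) (x1 : modulus x = 1) m : disk R :=
  mkdisk (modulus_radial m x1).

Lemma one_sub_modulus_radial x (x1 : modulus x = 1) m :
  1 - modulus (coord (radial_point x1 m)) = m.+1%:R^-1.
Proof.
have /andP[r0 r1] := radius01 R m.
by rewrite coord_mkdisk modulusM modulus_real x1 mulr1 ger0_norm// /radius subKr.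
Qed.

Lemma modulus_sub_radial x (x1 : modulus x = 1) m :
  modulus (coord (radial_point x1 m) - x) = m.+1%:R^-1.
Proof.
have -> : coord (radial_point x1 m) - x = (- (m.+1%:R^-1 : R))%:C%C * x.
  by rewrite coord_mkdisk /radius rmorphB rmorphN /= mulrBl mul1r addrAC subrr
    add0r mulNr.
by rewrite modulusM modulus_real x1 mulr1 normrN ger0_norm.
Qed.

Lemma tends_radial x (x1 : modulus x = 1) :
  tends \oo (fun m => coord (radial_point x1 m)) x.
Proof.
apply: (@cvgc_le0 _ _ _ _ _ _ (@harmonic R)); last exact: cvg_harmonic.
by apply: nearW => m; rewrite modulus_sub_radial.
Qed.

Lemma disk_neq_circle (z : disk R) (x : R[i]) : modulus x = 1 -> coord z - x != 0.
Proof.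
move=> x1; rewrite subr_eq0; apply: contraTneq (disk_modulus z) => ->.
by rewrite x1 ltxx.
Qed.

(** On the radius to x one has |z - x| = 1 - |z|, so tameness makes the right-hand side tend to
    0. *)
Lemma tame_root (x : R[i]) (p : {poly R[i]}) G : modulus x = 1 -> tame G ->
  (forall z : disk R, p.[coord z] = (coord z - x) * G z) -> p.[x] = 0.
Proof.
move=> x1 tG pG.
have px : tends \oo (fun m => p.[coord (radial_point x1 m)]) p.[x].
  by apply: tends_horner; exact: tends_radial.
apply: (cvgc_unique px).
apply/cvgcP/cvgrPdist_le => e e0; have [d d0 Gd] := tG _ e0.
have := @cvg_harmonic R; move=> /cvgrPdist_lt /(_ _ d0); apply: filterS => m.
rewrite /= sub0r normrN ger0_norm// => md.
rewrite sub0r normrN ger0_norm ?modulus_ge0// subr0.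
have pz := pG (radial_point x1 m); rewrite /= in pz; rewrite pz modulusM.
have dz := modulus_sub_radial x1 m; rewrite /= in dz; rewrite dz.
rewrite -(one_sub_modulus_radial x1); apply: Gd.
by rewrite one_sub_modulus_radial.
Qed.

Lemma tame_division_XsubC (x : R[i]) (p : {poly R[i]}) G : modulus x = 1 ->
  tame G -> (forall z : disk R, p.[coord z] = (coord z - x) * G z) ->
  exists2 q, p = ('X - x%:P) * q & forall z, G z = q.[coord z].
Proof.
move=> x1 tG pG; have /eqP/factor_theorem[q qE] := tame_root x1 tG pG.
exists q; first by rewrite mulrC.
move=> z; apply: (mulfI (disk_neq_circle z x1)).
by rewrite -pG qE hornerM hornerXsubC mulrC.
Qed.

(* Each factor X - x of a is cancelled by letting z tend radially to x. *)
Lemma tame_division (s : seq R[i]) (p : {poly R[i]}) G :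
  (forall x, x \in s -> modulus x = 1) -> tame G ->
  (forall z : disk R, p.[coord z] = (\prod_(x <- s) ('X - x%:P)).[coord z] * G z) ->
  exists2 q, p = (\prod_(x <- s) ('X - x%:P)) * q & forall z, G z = q.[coord z].
Proof.
elim: s p => [|x s IH] p s1 tG pG.
  exists p; first by rewrite big_nil mul1r.
  by move=> z; rewrite pG big_nil hornerC mul1r.
have [|||p' pE p'G] := @tame_division_XsubC x p
    (fun z => (\prod_(x <- s) ('X - x%:P)).[coord z] * G z).
- exact/s1/mem_head.
- exact: tameM_poly.
- by move=> z; rewrite pG big_cons hornerM hornerXsubC mulrA.
have [||q qE qG] := IH p' _ tG; last by exists q => //; rewrite big_cons pE qE mulrA.
- by move=> y ys; apply: s1; rewrite inE ys orbT.
- by move=> z; rewrite p'G.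
Qed.

End Growth.

(** * Gliding hump *)

Section GlidingHump.
Variable R : realType.
Local Notation mu := (@lebesgue_measure R).
Local Notation A := (angles R).

(* One of |S + u| and |S - u| is at least |u|, so the signs can be chosen one
   after the other. *)
Lemma exists_signs (u : nat -> nat -> R[i]) : exists2 s : nat -> R[i],
  (forall j, modulus (s j) = 1) &
  forall n, modulus (u n n) <= modulus (\sum_(0 <= j < n.+1) s j * u j n).
Proof.
pose sgn n (S : nat -> R[i]) : R[i] :=
  if modulus (u n n) <= modulus (S n + u n n) then 1 else -1.
(* [S n k] is the signed sum of the [u j k] over j < n; the sign of index n is decided by its value
   at k = n alone. *)
pose fix S n : nat -> R[i] := if n is m.+1
  then fun k => S m k + sgn m (S m) * u m k else fun=> 0.
exists (fun n => sgn n (S n)).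
  by move=> j; rewrite /sgn; case: ifP; rewrite ?modulusN modulus1.
have SE n k : S n k = \sum_(0 <= j < n) sgn j (S j) * u j k.
  elim: n => [|n IH]; first by rewrite big_geq.
  by rewrite big_nat_recr //= -IH.
move=> n; rewrite -SE /= /sgn; case: ifPn => [|]; first by rewrite mul1r.
rewrite -ltNge mulN1r => lt1.
have := le_modulusB (S n n + u n n) (S n n - u n n).
have -> : S n n + u n n - (S n n - u n n) = 2%:R * u n n by ring.
have -> : modulus (2%:R * u n n) = 2 * modulus (u n n).
  by rewrite modulusM -(rmorph_nat (real_complex R)) modulus_real ger0_norm.
by move: lt1; lra.
Qed.

(** The weighted variance of y about its mean S / W is nonnegative. *)
Lemma sqr_weighted_sum (w y : nat -> R) n :
  (forall j, 0 <= w j) -> 0 < \sum_(0 <= j < n) w j ->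
  (\sum_(0 <= j < n) w j * y j) ^+ 2 <=
  (\sum_(0 <= j < n) w j) * \sum_(0 <= j < n) w j * y j ^+ 2.
Proof.
move=> w0 W0; set W := \sum_(0 <= j < n) w j in W0 *.
set S := \sum_(0 <= j < n) w j * y j; set Q := \sum_(0 <= j < n) w j * y j ^+ 2.
have : 0 <= \sum_(0 <= j < n) w j * (y j - S / W) ^+ 2.
  by apply: sumr_ge0 => j _; rewrite mulr_ge0 ?sqr_ge0.
have -> : \sum_(0 <= j < n) w j * (y j - S / W) ^+ 2 =
    Q - 2 * (S / W) * S + (S / W) ^+ 2 * W.
  rewrite /Q /S /W !mulr_sumr -sumrB -big_split /=.
  by apply: eq_bigr => j _; ring.
have -> : Q - 2 * (S / W) * S + (S / W) ^+ 2 * W = (W * Q - S ^+ 2) / W.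
  by field; rewrite gt_eqF.
by rewrite pmulr_lge0 ?invr_gt0// subr_ge0.
Qed.

Lemma geometric_remainder (n a b : R[i]) K : 1 - a * b != 0 ->
  n / (1 - a * b) - \sum_(0 <= k < K) n * a ^+ k * b ^+ k =
  n / (1 - a * b) * (a * b) ^+ K.
Proof.
move=> ab; elim: K => [|K IH]; first by rewrite big_geq// subr0 mulr1.
rewrite big_nat_recr //= opprD addrA IH !exprMn !exprSr.
move: (a ^+ K) (b ^+ K) => a' b'.
by field.
Qed.

(** With ratio 1/3 all weights after the n-th add up to q^n / 2, so the later humps can cancel at
    most half of the n-th one. The recurring factor 3/2 is 1 / (1 - q). *)
Let q : R := 3^-1.

Lemma q_ge0 j : 0 <= q ^+ j.
Proof. by rewrite exprn_ge0// /q invr_ge0. Qed.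

Lemma sum_q_le n m : \sum_(n <= j < m) q ^+ j <= 3 / 2 * q ^+ n.
Proof.
have [mn|/ltnW nm] := leqP m n.
  by rewrite big_geq// mulr_ge0 ?q_ge0.
rewrite -{1}(add0n n) big_addn.
under eq_bigr do rewrite exprD.
rewrite -mulr_suml ler_wpM2r ?q_ge0//.
have := @geometric_sum_le R q (m - n) _.
have -> : 0 <= q < 1 by rewrite /q; apply/andP; split; lra.
by move=> /(_ isT); rewrite /q; lra.
Qed.

(** * Sums with geometrically decaying weights *)

Section WeightedSum.
Variable al : nat -> R[i].
Hypothesis al_q : forall j, modulus (al j) = q ^+ j.
Implicit Types u v : nat -> R[i].

(** The value 0 is a default for a divergent series; for bounded u the weights make the series
    converge. *)
Definition wsum u : R[i] := xget 0 (tends \oo (series (fun j => al j * u j))).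

Lemma wsum_tends u B : (forall j, modulus (u j) <= B) ->
  tends \oo (series (fun j => al j * u j)) (wsum u).
Proof.
move=> uB; rewrite /wsum; apply: xgetPex.
have [||l Hl _] := @cvgc_series_dominated R (fun j => al j * u j)
    (fun j => B * q ^+ j).
- by move=> j; rewrite modulusM al_q mulrC ler_wpM2r ?q_ge0.
- apply: is_cvg_geometric_series; rewrite ger0_norm /q; lra.
- by exists l.
Qed.

Lemma wsum_unique u B l : (forall j, modulus (u j) <= B) ->
  tends \oo (series (fun j => al j * u j)) l -> wsum u = l.
Proof. by move=> /wsum_tends uW ul; exact: cvgc_unique uW ul. Qed.

Lemma wsum_tail u B n : (forall j, modulus (u j) <= B) ->
  modulus (wsum u - \sum_(0 <= j < n) al j * u j) <= B * (3 / 2 * q ^+ n).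
Proof.
move=> uB; have B0 : 0 <= B by apply: le_trans (uB 0%N); exact: modulus_ge0.
have c0 : tends \oo (fun _ : nat => \sum_(0 <= j < n) al j * u j)
                    (\sum_(0 <= j < n) al j * u j) by exact: cvgc_cst.
apply: cvgc_modulus_le (cvgcB (wsum_tends uB) c0) _.
near=> m; have nm : (n <= m)%N by near: m; exact: nbhs_infty_ge.
rewrite /series /= (big_cat_nat (leq0n n) nm) /= addrAC subrr add0r.
apply: le_trans (modulus_sum _ _ _) _.
apply: le_trans (_ : \sum_(n <= j < m) B * q ^+ j <= _).
  by apply: ler_sum => j _; rewrite modulusM al_q mulrC ler_wpM2r ?q_ge0.
by rewrite -mulr_sumr ler_wpM2l// sum_q_le.
Unshelve. all: by end_near. Qed.

Lemma wsum_le u B : (forall j, modulus (u j) <= B) ->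
  modulus (wsum u) <= B * (3 / 2).
Proof.
by move=> uB; have := wsum_tail 0 uB; rewrite big_geq// subr0 expr0 mulr1.
Qed.

Lemma wsumD u v B C : (forall j, modulus (u j) <= B) ->
  (forall j, modulus (v j) <= C) ->
  wsum (fun j => u j + v j) = wsum u + wsum v.
Proof.
move=> uB vC; apply: (@wsum_unique _ (B + C)).
  by move=> j; apply: le_trans (le_modulusD _ _) _; rewrite lerD.
apply: (eq_tends _ (cvgcD (wsum_tends uB) (wsum_tends vC))) => n.
by rewrite /series /= -big_split /=; apply: eq_bigr => j _; rewrite mulrDr.
Qed.

Lemma wsumZ u B (c : R[i]) : (forall j, modulus (u j) <= B) ->
  wsum (fun j => u j * c) = wsum u * c.
Proof.
move=> uB; apply: (@wsum_unique _ (B * modulus c)).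
  by move=> j; rewrite modulusM ler_wpM2r ?modulus_ge0.
have cc : tends \oo (fun _ : nat => c) c by exact: cvgc_cst.
apply: (eq_tends _ (cvgcM (wsum_tends uB) cc)) => n.
by rewrite /series /= mulr_suml; apply: eq_bigr => j _; rewrite mulrA.
Qed.

Lemma wsumB u v B C : (forall j, modulus (u j) <= B) ->
  (forall j, modulus (v j) <= C) ->
  wsum (fun j => u j - v j) = wsum u - wsum v.
Proof.
move=> uB vC; rewrite -[- wsum v]mulrN1 -(wsumZ _ vC).
rewrite -(wsumD uB (C := C)).
  by congr wsum; apply/funext => j; rewrite mulrN1.
by move=> j; rewrite mulrN1 modulusN.
Qed.

Lemma wsum_sum (v : nat -> nat -> R[i]) (c : nat -> R[i]) B K :
  (forall k j, modulus (v k j) <= B) ->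
  wsum (fun j => \sum_(0 <= k < K) v k j * c k) =
  \sum_(0 <= k < K) wsum (v k) * c k.
Proof.
move=> vB; elim: K => [|K IH].
  rewrite big_geq//; apply: (@wsum_unique _ 0).
    by move=> j; rewrite big_geq// modulus0.
  apply: tends_near_cst; apply: nearW => n.
  by rewrite /series /= big1// => j _; rewrite big_geq// mulr0.
rewrite big_nat_recr //= -IH -(wsumZ _ (vB K)).
rewrite -(@wsumD _ _ (\sum_(0 <= k < K) B * modulus (c k)) (B * modulus (c K))).
- by congr wsum; apply/funext => j; rewrite big_nat_recr.
- move=> j; apply: le_trans (modulus_sum _ _ _) _; apply: ler_sum => k _.
  by rewrite modulusM ler_wpM2r ?modulus_ge0.
- by move=> j; rewrite modulusM ler_wpM2r ?modulus_ge0.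
Qed.

(** * Normalized Cauchy kernels at points tending to the circle *)

Section Kernels.
Variables (z : nat -> disk R) (x : R[i]).
Hypothesis x1 : modulus x = 1.
Hypothesis zx : tends \oo (fun n => coord (z n)) x.

(** The reciprocal of the H^2 norm of w |-> 1 / (1 - conj(z_j) w), so that [kernel j] is a unit
    vector. *)
Definition kernel_norm j : R := Num.sqrt (1 - modulus (coord (z j)) ^+ 2).

Lemma kernel_norm_sqr j : kernel_norm j ^+ 2 = 1 - modulus (coord (z j)) ^+ 2.
Proof.
rewrite /kernel_norm sqr_sqrtr// subr_ge0 exprn_ile1 ?modulus_ge0//.
exact/ltW/disk_modulus.
Qed.

Lemma sqr_modulus_lt1 (w : disk R) : 0 < 1 - modulus (coord w) ^+ 2.
Proof.
have w1 := disk_modulus w; have w0 := modulus_ge0 (coord w).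
by rewrite subr_gt0 expr2; apply: le_lt_trans (w1); rewrite ler_piMl// ltW.
Qed.

Lemma kernel_norm_gt0 j : 0 < kernel_norm j.
Proof. by rewrite sqrtr_gt0 sqr_modulus_lt1. Qed.

Lemma kernel_norm_le1 j : kernel_norm j <= 1.
Proof.
rewrite -(@ler_pXn2r _ 2) ?nnegrE ?sqrtr_ge0// kernel_norm_sqr expr1n.
by rewrite gerBl sqr_ge0.
Qed.

Definition kernel j (w : R[i]) : R[i] :=
  (kernel_norm j)%:C%C / (1 - conjc (coord (z j)) * w).

Lemma modulus_kernel j w : modulus (kernel j w) =
  kernel_norm j / modulus (1 - conjc (coord (z j)) * w).
Proof.
by rewrite modulusM modulusV modulus_real ger0_norm// ltW// kernel_norm_gt0.
Qed.

Lemma kernel_den_ge (w : disk R) (v : R[i]) : modulus v <= 1 ->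
  1 - modulus (coord w) <= modulus (1 - conjc (coord w) * v).
Proof.
move=> v1; apply: le_trans (lerB_modulus _ _).
rewrite modulus1 modulusM modulus_conj lerD2l lerN2.
by rewrite ler_piMr ?modulus_ge0.
Qed.

Lemma kernel_den_neq0 (w : disk R) (v : R[i]) : modulus v <= 1 ->
  1 - conjc (coord w) * v != 0.
Proof.
move=> v1; rewrite -modulus_eq0 gt_eqF//.
by apply: lt_le_trans (kernel_den_ge w v1); exact: one_sub_modulus_gt0.
Qed.

(** The identity behind the pseudohyperbolic distance; dropping |y - w|^2 yields [kernel_le]. *)
Lemma modulus_sqr_sub (y w : R[i]) : modulus (1 - conjc y * w) ^+ 2 =
  (1 - modulus y ^+ 2) * (1 - modulus w ^+ 2) + modulus (y - w) ^+ 2.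
Proof.
rewrite !modulus_sqr; case: y => a b; case: w => c d /=.
ring.
Qed.

(** The pointwise bound on unit vectors of H^2, uniform in j; by [kernel_diag] it is attained at w =
    z_j. *)
Lemma kernel_le j (w : disk R) :
  modulus (kernel j (coord w)) <= (Num.sqrt (1 - modulus (coord w) ^+ 2))^-1.
Proof.
have s0 : 0 < Num.sqrt (1 - modulus (coord w) ^+ 2).
  by rewrite sqrtr_gt0 sqr_modulus_lt1.
have d0 : 0 < modulus (1 - conjc (coord (z j)) * coord w).
  by rewrite lt_def modulus_eq0 kernel_den_neq0 ?modulus_ge0// ltW// disk_modulus.
rewrite modulus_kernel ler_pdivrMr// mulrC ler_pdivlMr//.
rewrite -(@ler_pXn2r _ 2) ?nnegrE ?mulr_ge0 ?modulus_ge0 ?sqrtr_ge0//.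
rewrite exprMn kernel_norm_sqr sqr_sqrtr ?(ltW (sqr_modulus_lt1 w))//.
by rewrite modulus_sqr_sub lerDl sqr_ge0.
Qed.

Lemma kernel_diag n : modulus (kernel n (coord (z n))) = (kernel_norm n)^-1.
Proof.
rewrite modulus_kernel mulrC [conjc _ * _]mulrC mulc_conj.
have -> : 1 - (modulus (coord (z n)) ^+ 2)%:C%C = (kernel_norm n ^+ 2)%:C%C.
  by rewrite kernel_norm_sqr rmorphB.
have k0 := kernel_norm_gt0 n.
rewrite modulus_real ger0_norm ?sqr_ge0//; field.
by rewrite gt_eqF.
Qed.

Lemma kernel_remainder j (w : disk R) K :
  kernel j (coord w) - \sum_(0 <= k < K)
    (kernel_norm j)%:C%C * conjc (coord (z j)) ^+ k * coord w ^+ k =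
  kernel j (coord w) * (conjc (coord (z j)) * coord w) ^+ K.
Proof. exact/geometric_remainder/kernel_den_neq0/ltW/disk_modulus. Qed.

Definition hump (w : disk R) : R[i] := wsum (fun j => kernel j (coord w)).

Definition hump_coef k : R[i] :=
  wsum (fun j => (kernel_norm j)%:C%C * conjc (coord (z j)) ^+ k).

Lemma coef_le1 k j : modulus ((kernel_norm j)%:C%C * conjc (coord (z j)) ^+ k) <= 1.
Proof.
rewrite modulusM modulusX modulus_conj modulus_real.
rewrite (ger0_norm (ltW (kernel_norm_gt0 j))) mulr_ile1 ?(ltW (kernel_norm_gt0 j))//.
- by rewrite exprn_ge0 ?modulus_ge0.
- exact: kernel_norm_le1.
- by rewrite exprn_ile1 ?modulus_ge0// ltW// disk_modulus.
Qed.

(** The Taylor remainders of the kernels at w are at most B |w|^K uniformly in j, which lets the two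
    summations be exchanged. *)
Lemma hump_has_coefs : has_coefs hump hump_coef.
Proof.
move=> w; set r := modulus (coord w).
have r0 : 0 <= r by exact: modulus_ge0.
have r1 : r < 1 by exact: disk_modulus.
set B := (Num.sqrt (1 - modulus (coord w) ^+ 2))^-1.
have kB j : modulus (kernel j (coord w)) <= B by exact: kernel_le.
have B0 : 0 <= B by rewrite invr_ge0 sqrtr_ge0.
apply: (@cvgc_le0 _ _ _ _ _ _ (fun K => B * (3 / 2) * r ^+ K)).
  apply: nearW => K.
  have bK j : modulus (\sum_(0 <= k < K)
      (kernel_norm j)%:C%C * conjc (coord (z j)) ^+ k * coord w ^+ k) <=
      \sum_(0 <= k < K) 1.
    apply: le_trans (modulus_sum _ _ _) _; apply: ler_sum => k _.
    rewrite modulusM -[leRHS]mulr1; apply: ler_pM; rewrite ?modulus_ge0 ?coef_le1//.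
    by rewrite modulusX exprn_ile1// ltW.
  rewrite modulusB /series /= /hump_coef -(wsum_sum _ _ coef_le1) /hump.
  rewrite -(wsumB kB bK) mulrAC; apply: wsum_le => j.
  rewrite kernel_remainder modulusM modulusX modulusM modulus_conj.
  apply: ler_pM; rewrite ?modulus_ge0 ?exprn_ge0 ?mulr_ge0 ?modulus_ge0//.
  rewrite lerXn2r ?nnegrE ?mulr_ge0 ?modulus_ge0// ler_piMl// ltW//.
  exact: disk_modulus.
rewrite -[X in _ --> X](mulr0 (B * (3 / 2))); apply: cvgM; first exact: cvg_cst.
by apply: cvg_expr; rewrite ger0_norm.
Qed.

(** The triangle inequality in H^2 for unit vectors, done on coefficients: the weighted
    Cauchy-Schwarz inequality costs one factor W <= 3/2, and the sum over j gives a second one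
    because the squared coefficients of each kernel add up to at most 1. *)
Lemma hump_coefs_bounded K : \sum_(0 <= k < K) modulus (hump_coef k) ^+ 2 <= (3 / 2) ^+ 2.
Proof.
pose b j k := (kernel_norm j)%:C%C * conjc (coord (z j)) ^+ k.
have tk k : tends \oo (series (fun j => al j * b j k)) (hump_coef k).
  exact: wsum_tends (coef_le1 k).
have ck : (fun n => \sum_(0 <= k < K)
      modulus (series (fun j => al j * b j k) n) ^+ 2) @ \oo -->
    \sum_(0 <= k < K) modulus (hump_coef k) ^+ 2.
  apply: cvg_big => [|k _]; first exact: add_continuous.
  have tm : modulus (series (fun j => al j * b j k) n) @[n --> \oo] -->
      modulus (hump_coef k) by exact: cvgc_modulus (tk k).
  by rewrite [X in _ --> X]expr2; under eq_fun do rewrite expr2; exact: cvgM.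
rewrite -(cvg_lim (@Rhausdorff R) ck); apply: limr_le.
  by apply/cvg_ex; eexists; exact: ck.
near=> n; have n0 : (0 < n)%N by near: n; exact: nbhs_infty_gt.
pose W := \sum_(0 <= j < n) q ^+ j.
have W0 : 0 < W.
  rewrite /W big_ltn// expr0 ltr_wpDr// sumr_ge0// => j _; exact: q_ge0.
have WM : W <= 3 / 2 by have := sum_q_le 0 n; rewrite expr0 mulr1.
apply: le_trans (_ : \sum_(0 <= k < K) W * \sum_(0 <= j < n)
    q ^+ j * modulus (b j k) ^+ 2 <= _).
  apply: ler_sum => k _.
  apply: le_trans (sqr_weighted_sum _ q_ge0 W0).
  rewrite lerXn2r ?nnegrE ?modulus_ge0//.
    by apply: sumr_ge0 => j _; rewrite mulr_ge0 ?q_ge0 ?modulus_ge0.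
  apply: le_trans (modulus_sum _ _ _) _; apply: ler_sum => j _.
  by rewrite modulusM al_q.
rewrite -mulr_sumr exchange_big /= expr2.
apply: ler_pM => //; first exact: ltW.
  apply: sumr_ge0 => j _; apply: sumr_ge0 => k _.
  by rewrite mulr_ge0 ?q_ge0 ?sqr_ge0.
apply: le_trans WM; apply: ler_sum => j _; rewrite -mulr_sumr.
rewrite ler_piMr ?q_ge0//.
have sqb k : modulus (b j k) ^+ 2 =
    (1 - modulus (coord (z j)) ^+ 2) * (modulus (coord (z j)) ^+ 2) ^+ k.
  rewrite modulusM modulusX modulus_conj modulus_real exprMn.
  by rewrite real_normK ?num_real// kernel_norm_sqr -exprM mulnC exprM.
under eq_bigr do rewrite sqb.
rewrite -mulr_sumr; apply: geometric_sum_le.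
by rewrite sqr_ge0 -subr_gt0 sqr_modulus_lt1.
Unshelve. all: by end_near. Qed.

Lemma hump_H2 : H2 hump.
Proof. exact: H2_of_coefs hump_has_coefs hump_coefs_bounded. Qed.

Lemma kernel_den_min n0 : exists2 d : R, 0 < d &
  forall j, (j < n0)%N -> d <= 1 - modulus (coord (z j)).
Proof.
elim: n0 => [|n [d d0 dn]]; first by exists 1.
exists (Num.min d (1 - modulus (coord (z n)))).
  by rewrite lt_min d0 one_sub_modulus_gt0.
move=> j; rewrite ltnS leq_eqVlt => /predU1P[->|/dn dj].
  by rewrite ge_min lexx orbT.
by rewrite ge_min dj.
Qed.

(** Away from x the denominators are bounded below on a whole radius, uniformly in j: all but
    finitely many z_j are close to x, and each of the others has its own bound 1 - |z_j|. *)
Lemma kernel_den_away (e : R[i]) : modulus e = 1 -> e != x ->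
  exists2 d : R, 0 < d & forall j (r : R), 0 <= r <= 1 ->
    d <= modulus (1 - conjc (coord (z j)) * (r%:C%C * e)).
Proof.
move=> e1 ex; pose y := modulus (x - e).
have y0 : 0 < y by rewrite lt_def modulus_eq0 modulus_ge0 subr_eq0 eq_sym ex.
have [n0 _ Hn] : \forall n \near \oo, modulus (coord (z n) - x) < y / 4.
  have /cvgcP/cvgrPdist_lt H := zx; have y4 : 0 < y / 4 by rewrite divr_gt0.
  apply: filterS (H _ y4) => n.
  by rewrite sub0r normrN ger0_norm ?modulus_ge0.
have [d d0 dn] := kernel_den_min n0.
exists (Num.min d (y / 4)); first by rewrite lt_min d0 divr_gt0.
move=> j r /andP[r0 r1].
have re1 : modulus (r%:C%C * e) <= 1 by rewrite modulusM e1 mulr1 modulus_real ger0_norm.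
rewrite ge_min; have [jn|nj] := ltnP j n0.
  by rewrite (le_trans (dn _ jn) (kernel_den_ge _ re1)).
apply/orP; right.
have zj : modulus (coord (z j) - x) < y / 4 by exact: Hn.
(* As |x| = 1, 1 - r <= |x - r e|, whence y <= |x - r e| + (1 - r) <= 2 |x - r e|. *)
have xre : y / 2 <= modulus (x - r%:C%C * e).
  have h1 : 1 - r <= modulus (x - r%:C%C * e).
    apply: le_trans (lerB_modulus _ _).
    by rewrite x1 modulusM e1 mulr1 modulus_real ger0_norm.
  have h2 : y <= modulus (x - r%:C%C * e) + (1 - r).
    have -> : 1 - r = modulus ((1 - r)%:C%C * e).
      by rewrite modulusM e1 mulr1 modulus_real ger0_norm ?subr_ge0.
    rewrite [leLHS](_ : y = modulus ((x - r%:C%C * e) - (1 - r)%:C%C * e)).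
      exact: le_modulusB.
    by rewrite /y rmorphB /= rmorph1; congr modulus; ring.
  by lra.
(* Replacing z_j by x in the denominator costs at most y / 4. *)
have -> : modulus (1 - conjc (coord (z j)) * (r%:C%C * e)) =
    modulus (1 - conjc x * (r%:C%C * e) - conjc (coord (z j) - x) * (r%:C%C * e)).
  by rewrite rmorphB /=; congr modulus; ring.
apply: le_trans (lerB_modulus _ _).
have xx : x * conjc x = 1 by rewrite mulc_conj x1 expr1n.
have xE : x - r%:C%C * e = x * (1 - conjc x * (r%:C%C * e)).
  by rewrite mulrBr mulr1 [x * (_ * _)]mulrA xx mul1r.
rewrite xE modulusM x1 mul1r in xre.
have : modulus (conjc (coord (z j) - x) * (r%:C%C * e)) <= y / 4.
  rewrite modulusM modulus_conj; apply: le_trans (ltW zj).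
  by rewrite ler_piMr ?modulus_ge0.
by lra.
Qed.

Lemma kernel_away_le (e : R[i]) d j (r : R) : 0 < d ->
  d <= modulus (1 - conjc (coord (z j)) * (r%:C%C * e)) ->
  modulus (kernel j (r%:C%C * e)) <= d^-1.
Proof.
move=> d0 de; rewrite modulus_kernel.
have D0 : 0 < modulus (1 - conjc (coord (z j)) * (r%:C%C * e)) by exact: lt_le_trans de.
rewrite ler_pdivrMr//; apply: le_trans (kernel_norm_le1 j) _.
by rewrite mulrC ler_pdivlMr// mul1r.
Qed.

(** Along a radius not ending at x the increments of the kernels are at most d^-2 (1 - r), uniformly
    in j, so the limit passes through the weighted sum. *)
Lemma hump_tends (t : R) : expi t != x ->
  tends (1 : R)^'- (fun r => dilate hump r t) (wsum (fun j => kernel j (expi t))).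
Proof.
move=> tx; have e1 := modulus_expi t.
have [d d0 dE] := kernel_den_away e1 tx.
have eE : expi t = (1 : R)%:C%C * expi t by rewrite mul1r.
have d1 j : d <= modulus (1 - conjc (coord (z j)) * expi t).
  by rewrite eE; apply: dE; rewrite ler01 lexx.
have k1 j : modulus (kernel j (expi t)) <= d^-1.
  by rewrite eE; apply: kernel_away_le => //; apply: dE; rewrite ler01 lexx.
apply: (@cvgc_le0 _ _ _ _ _ _ (fun r => d^-1 * d^-1 * (3 / 2) * (1 - r))).
  near=> r; have r01 : 0 <= r < 1 by near: r; exact: near_left1.
  have /andP[r0 r1] := r01; have r01' : 0 <= r <= 1 by rewrite r0 ltW.
  rewrite (dilateE _ _ r01) /hump coord_mkdisk.
  have kr j : modulus (kernel j (polar r t)) <= d^-1.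
    by rewrite polarE; apply: kernel_away_le => //; apply: dE.
  rewrite -(wsumB kr k1) mulrAC; apply: wsum_le => j.
  have dr : d <= modulus (1 - conjc (coord (z j)) * polar r t).
    by rewrite polarE; exact: dE.
  have D0 := lt_le_trans d0 (d1 j); have Dr0 := lt_le_trans d0 dr.
  have n1 : 1 - conjc (coord (z j)) * expi t != 0 by rewrite -modulus_eq0 gt_eqF.
  have n2 : 1 - conjc (coord (z j)) * polar r t != 0 by rewrite -modulus_eq0 gt_eqF.
  have -> : kernel j (polar r t) - kernel j (expi t) =
     kernel j (polar r t) * (conjc (coord (z j)) * expi t * (r - 1)%:C%C /
       (1 - conjc (coord (z j)) * expi t)).
    rewrite /kernel rmorphB rmorph1; move: n1 n2; rewrite polarE => n1 n2.
    by field; rewrite n1 n2.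
  rewrite modulusM -[leRHS]mulrA.
  apply: ler_pM; [exact: modulus_ge0|exact: modulus_ge0|exact: kr|].
  rewrite modulusM modulusV [leRHS]mulrC.
  apply: ler_pM; [exact: modulus_ge0|by rewrite invr_ge0 modulus_ge0| |].
    rewrite !modulusM e1 modulus_conj mulr1 modulus_real distrC ger0_norm.
      by rewrite ler_piMl ?subr_ge0 ?(ltW r1)// ltW// disk_modulus.
    by rewrite subr_ge0 ltW.
  by rewrite lef_pV2.
rewrite -[X in _ --> X](mulr0 (d^-1 * d^-1 * (3 / 2))).
apply: cvgM; first exact: cvg_cst.
rewrite -(subrr (1 : R)); apply: cvgB; first exact: cvg_cst.
exact: cvg_at_left_filter.
Unshelve. all: by end_near. Qed.

(** The cosine determines an angle of [-pi, pi] up to sign. This encloses the exceptional angles in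
    an explicit finite, hence null, set. *)
Lemma expi_eq_pm (t : R) : A t -> expi t = x ->
  t = acos (complex.Re x) \/ t = - acos (complex.Re x).
Proof.
rewrite /angles /= in_itv /= => /andP[tl tr] tx.
have ct : cos t = complex.Re x by rewrite -tx.
have [t0|t0] := leP 0 t.
  by left; rewrite -ct cosK// in_itv /= t0.
by right; rewrite -ct -cosN cosK ?opprK// in_itv /= oppr_ge0 ltW//= lerNl.
Qed.

Lemma cmeas_kernel j : cmeas (fun t : R => kernel j (expi t)).
Proof.
set r := modulus (coord (z j)); have r1 : r < 1 by exact: disk_modulus.
have r0 : 0 <= r by exact: modulus_ge0.
pose b k := (kernel_norm j)%:C%C * conjc (coord (z j)) ^+ k.
apply: (cmeas_cvg (cmeas_trig b)) => t _.
apply: (@cvgc_le0 _ _ _ _ _ _ (fun K => modulus (kernel j (expi t)) * r ^+ K)).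
  apply: nearW => K.
  have E : kernel j (expi t) - trig b K t =
      kernel j (expi t) * (conjc (coord (z j)) * expi t) ^+ K.
    by apply: geometric_remainder; apply: kernel_den_neq0; rewrite modulus_expi.
  by rewrite modulusB E modulusM modulusX modulusM modulus_conj modulus_expi mulr1.
rewrite -[X in _ --> X](mulr0 (modulus (kernel j (expi t)))).
apply: cvgM; first exact: cvg_cst.
by apply: cvg_expr; rewrite ger0_norm.
Qed.

Lemma hump_H2b : H2b hump.
Proof.
split; first exact: hump_H2.
pose a := acos (complex.Re x).
pose N : set R := [set a] `|` [set - a].
have mN : measurable N by apply: measurableU; exact: measurable_set1.
have expN t : A t -> ~ N t -> expi t != x.
  by move=> At; apply: contra_notN => /eqP /(expi_eq_pm At).
(* This factor removes the exceptional angles, where the series of kernels may diverge, so that the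
   partial sums converge at every angle and [cmeas_cvg] applies. *)
pose ind t : R[i] := (\1_(~` N) t : R)%:C%C.
have mind : cmeas ind.
  split => /=; last exact: measurable_cst.
  by apply: measurable_funTS; apply: measurable_indic; exact: measurableC.
exists (fun t => wsum (fun j => kernel j (expi t)) * ind t).
have indN t : N t -> ind t = 0.
  by move=> Nt; rewrite /ind indicE memNset//= => /(_ Nt).
have indC t : ~ N t -> ind t = 1.
  by move=> Nt; rewrite /ind indicE mem_set.
have expi1 t : expi t = (1 : R)%:C%C * expi t by rewrite mul1r.
apply: boundary_mk; first exact: hump_H2.
  have mk n : cmeas (fun t => series (fun j => al j * kernel j (expi t)) n * ind t).
    apply: cmeasM => //; apply: cmeas_sum => j.
    by apply: cmeasM; [exact: cmeas_cst|exact: cmeas_kernel].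
  apply: (cmeas_cvg mk) => t At.
  have [Nt|Nt] := pselect (N t).
    by apply: tends_near_cst; apply: nearW => n; rewrite indN// !mulr0.
  have [d d0 dE] := kernel_den_away (modulus_expi t) (expN t At Nt).
  have k1 j : modulus (kernel j (expi t)) <= d^-1.
    by rewrite expi1; apply: kernel_away_le => //; apply: dE; rewrite ler01 lexx.
  have c1 : tends \oo (fun _ : nat => ind t) (ind t) by exact: cvgc_cst.
  exact: cvgcM (wsum_tends k1) c1.
exists N; split => //.
  rewrite measureU0//; first exact: lebesgue_measure_set1.
  exact: lebesgue_measure_set1.
move=> t /= H; apply: contrapT => Nt; apply: H => At.
rewrite (indC t Nt) mulr1; apply: hump_tends; exact: (expN t At Nt).
Qed.

End Kernels.
End WeightedSum.

(** Write k for [kernel_norm z n]. With signs from [exists_signs] the terms up to n have modulus at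
    least q^n / k at z_n, and the tail at most q^n / (2 k). So |h(z_n)| >= q^n / (2 k), and k^2 = 1
    - |z_n|^2 <= 2 (1 - |z_n|) gives the constant 8. *)
Lemma exists_H2b_large (z : nat -> disk R) (x : R[i]) : modulus x = 1 ->
  tends \oo (fun n => coord (z n)) x ->
  exists2 h, H2b h & forall n, (3^-1 ^+ n) ^+ 2 / 8 <=
     (1 - modulus (coord (z n))) * modulus (h (z n)) ^+ 2.
Proof.
move=> x1 zx.
have [s s1 sE] := exists_signs (fun j n => (q ^+ j)%:C%C * kernel z j (coord (z n))).
pose al j := s j * (q ^+ j)%:C%C.
have al_q j : modulus (al j) = q ^+ j.
  by rewrite modulusM s1 mul1r modulus_real ger0_norm ?q_ge0.
exists (hump al z); first exact: hump_H2b al_q _ _ x1 zx.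
move=> n; rewrite -/q; set k := kernel_norm z n; have k0 : 0 < k by exact: kernel_norm_gt0.
have kB j : modulus (kernel z j (coord (z n))) <= k^-1 by exact: kernel_le.
set S := \sum_(0 <= j < n.+1) al j * kernel z j (coord (z n)).
have tail : modulus (hump al z (z n) - S) <= k^-1 * (3 / 2 * q ^+ n.+1).
  by have := wsum_tail al_q n.+1 kB.
have main : q ^+ n * k^-1 <= modulus S.
  have := sE n; rewrite modulusM modulus_real (ger0_norm (q_ge0 _)) kernel_diag -/k.
  by under eq_bigr do rewrite mulrA.
move: tail main; move: S (hump al z (z n)) => S H tail main.
have low : q ^+ n / 2 <= k * modulus H.
  rewrite [leRHS]mulrC -ler_pdivrMr//.
  have SH := lerB_modulus S H; rewrite modulusB in SH.
  have kT : k^-1 * (3 / 2 * q ^+ n.+1) = q ^+ n / 2 / k.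
    by rewrite exprS /q; field; rewrite gt_eqF.
  have kM : q ^+ n * k^-1 = q ^+ n / 2 / k + q ^+ n / 2 / k.
    by field; rewrite gt_eqF.
  rewrite kT in tail; rewrite kM in main.
  move: (q ^+ n / 2 / k) SH tail main => T SH tail main; lra.
have low2 : (q ^+ n / 2) ^+ 2 <= (k * modulus H) ^+ 2.
  rewrite lerXn2r ?nnegrE ?mulr_ge0 ?modulus_ge0 ?(ltW k0)//.
  by rewrite q_ge0.
move: low2; rewrite exprMn [(k * _) ^+ 2]exprMn kernel_norm_sqr.
have r0 := modulus_ge0 (coord (z n)); have r1 := disk_modulus (z n).
move: (modulus (coord (z n))) r0 r1 (sqr_ge0 (modulus H)) => r r0 r1.
move: (modulus _ ^+ 2) ((q ^+ n) ^+ 2) => y p y0 h1.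
have h2 : (1 - r ^+ 2) * y <= 2 * (1 - r) * y.
  by rewrite ler_wpM2r//; nra.
have -> : p / 8 = p * 2^-1 ^+ 2 / 2 by field.
by move: h1 h2; rewrite -mulrA; lra.
Qed.

End GlidingHump.

(** * Multipliers *)

(** This identity and the next two exhibit the polynomial part q of an expansion as a multiple of
    the factor to be divided out: z - x, then a1, then a2 = a1 k. *)
Lemma sub_of_eq_add1 (K : comPzRingType) (p d h k g q : K) :
  p * d * h = d * k * g + q -> q = d * (p * h - k * g).
Proof.
move=> E; have -> : q = p * d * h - d * k * g by rewrite E addrAC subrr add0r.
by ring.
Qed.

Lemma sub_of_eq_add2 (K : comPzRingType) (a k g p h gh q : K) :
  (a * k * g + p) * (a * h) = a * k * gh + q ->
  q = a * (p * h - k * (gh - a * (g * h))).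
Proof.
move=> E; have -> : q = (a * k * g + p) * (a * h) - a * k * gh.
  by rewrite E addrAC subrr add0r.
by ring.
Qed.

Lemma sub_of_eq_add3 (K : comPzRingType) (a k s h g q : K) :
  k * s * (a * h) = a * k * g + q -> q = a * k * (s * h - g).
Proof.
move=> E; have -> : q = k * s * (a * h) - a * k * g.
  by rewrite E addrAC subrr add0r.
by ring.
Qed.

Lemma mul_split (K : comPzRingType) (a k u p1 v p2 : K) :
  k * (a * v + p2) * (a * u + p1) =
  a * k * ((a * v + p2) * u + p1 * v) + k * p2 * p1.
Proof. by ring. Qed.

Section Unbounded.
Variable R : realType.
Implicit Types (f g h : disk R -> R[i]).

(** Bolzano-Weierstrass, from the compactness of the square [-1, 1]^2 that contains the real and
    imaginary parts. *)
Lemma disk_cluster (z : nat -> disk R) : exists x : R[i],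
  forall (e : R) N, 0 < e -> exists2 n, (N <= n)%N & modulus (coord (z n) - x) < e.
Proof.
pose K : set (R * R) := `[-1, 1]%classic `*` `[-1, 1]%classic.
have cK : compact K by apply: compact_setX; exact: segment_compact.
pose P n : R * R := (complex.Re (coord (z n)), complex.Im (coord (z n))).
have PK : (P @ \oo) K.
  exists 0%N => // n _; split => /=; rewrite in_itv /= -ler_norml.
    by apply: le_trans (Re_le_modulus _) _; exact/ltW/disk_modulus.
  by apply: le_trans (Im_le_modulus _) _; exact/ltW/disk_modulus.
have [[a b] [_ cab]] := cK (P @ \oo) _ PK.
exists (Complex a b) => e N e0; have e2 : 0 < e / 2 by rewrite divr_gt0.
have PA : (P @ \oo) (P @` [set n | (N <= n)%N]).
  by exists N => // n /= Nn; exists n.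
have nB : nbhs (a, b) [set y : R * R | `|a - y.1| < e / 2 /\ `|b - y.2| < e / 2].
  exists ([set u | `|a - u| < e / 2], [set v | `|b - v| < e / 2]).
    by split; [exact: (nbhsx_ballx a _ e2)|exact: (nbhsx_ballx b _ e2)].
  by move=> [u v] [].
have [y [[n Nn <-] [/= ra ib]]] := cab _ _ PA nB.
exists n => //; apply: le_lt_trans (modulus_le_ReIm _) _.
rewrite ReD ImD ReN ImN /= distrC [X in _ + X]distrC (splitr e).
exact: ltrD.
Qed.

(** Points with |f| > n accumulate at some x, and a subsequence tending to x can be thinned until
    |f| outruns any prescribed w. If |x| < 1, f would be bounded along it. *)
Lemma unbounded_cluster f (w : nat -> R) : analytic f ->
  ~ (exists M : R, forall z, modulus (f z) <= M) ->
  exists x (z : nat -> disk R), [/\ modulus x = 1,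
    tends \oo (fun n => coord (z n)) x & forall n, w n <= modulus (f (z n))].
Proof.
move=> [c fc] nb.
have big n : exists z : disk R, n%:R < modulus (f z).
  apply: contra_notP nb => /forallNP nz; exists n%:R => z.
  by rewrite leNgt; exact/negP/nz.
have [zz zzE] := choice big; have [x xE] := disk_cluster zz.
have wn n : exists N : nat, w n <= N%:R /\ (n <= N)%N.
  exists (maxn (Num.bound `|w n|) n); split; last exact: leq_maxr.
  apply: le_trans (ler_norm _) _; apply: le_trans (ltW (archi_boundP (normr_ge0 _))) _.
  by rewrite ler_nat leq_maxl.
have [N NE] := choice wn.
have sub m : exists n, (N m <= n)%N /\ modulus (coord (zz n) - x) < m.+1%:R^-1.
  have [|n Nn xn] := xE (m.+1%:R^-1) (N m); first by rewrite invr_gt0 ltr0n.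
  by exists n.
have [k kE] := choice sub.
have zx : tends \oo (fun m => coord (zz (k m))) x.
  apply: (@cvgc_le0 _ _ _ _ _ _ (@harmonic R)); last exact: cvg_harmonic.
  by apply: nearW => m; exact/ltW/(kE m).2.
have fk m : m%:R <= modulus (f (zz (k m))).
  apply: le_trans (ltW (zzE (k m))); rewrite ler_nat.
  exact: leq_trans (NE m).2 (kE m).1.
exists x, (fun m => zz (k m)); split => //; last first.
  move=> m; apply: le_trans (NE m).1 _; apply: le_trans (ltW (zzE (k m))).
  by rewrite ler_nat (kE m).1.
have x1 : modulus x <= 1.
  by apply: cvgc_modulus_le zx _; apply: nearW => m; exact/ltW/disk_modulus.
apply/le_anti; rewrite x1 leNgt; apply/negP => xlt.
pose r := (1 + modulus x) / 2; have x0 := modulus_ge0 x.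
have [|M M0 fM] := has_coefs_bounded (r := r) fc; first by rewrite /r; apply/andP; split; lra.
have zr : \forall m \near \oo, modulus (coord (zz (k m))) <= r.
  have /cvgrPdist_lt : modulus (coord (zz (k m))) @[m --> \oo] --> modulus x.
    exact: cvgc_modulus zx.
  have r0 : 0 < r - modulus x by rewrite /r; lra.
  move=> /(_ _ r0); apply: filterS => m; rewrite distrC ltr_norml => /andP[_].
  by rewrite ltrBlDr subrK => /ltW.
have [m [mr mM]] : exists m, modulus (coord (zz (k m))) <= r /\ M < m%:R.
  near \oo => m; exists m; split; first by near: m.
  near: m; exists (Num.bound M) => // m /= bm.
  apply: lt_le_trans (_ : (Num.bound M)%:R <= _); last by rewrite ler_nat.
  by have := archi_boundP M0.
by have := le_lt_trans (le_trans (fk m) (fM _ mr)) mM; rewrite ltxx.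
Unshelve. all: by end_near. Qed.

Lemma multiplier_bounded f : analytic f ->
  (forall h, H2b h -> H2 (fun z => f z * h z)) ->
  exists M : R, forall z, modulus (f z) <= M.
Proof.
move=> fa fh; apply: contrapT => nb.
(* The rate 3^n n cancels the loss 9^-n / 8 of the hump: (1 - |z_n|) |f h|^2 is at least n^2 / 8,
   against the growth bound for f h in H^2. *)
have [x [z [x1 zx fz]]] := unbounded_cluster (fun n => 3 ^+ n * n%:R) fa nb.
have [h Hh hz] := exists_H2b_large x1 zx.
have [M M0 gM] := H2_growth (fh h Hh).
have nM n : n%:R ^+ 2 <= 8 * M.
  have := gM (z n); rewrite modulusM exprMn mulrCA => le1.
  have : (3 ^+ n * n%:R) ^+ 2 * ((3^-1 ^+ n) ^+ 2 / 8) <= M.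
    apply: le_trans le1.
    apply: ler_pM (hz n); [exact: sqr_ge0|by rewrite divr_ge0 ?sqr_ge0|].
    by rewrite lerXn2r ?nnegrE ?modulus_ge0 ?mulr_ge0 ?exprn_ge0.
  have -> : (3 ^+ n * n%:R) ^+ 2 * ((3^-1 ^+ n) ^+ 2 / 8) = n%:R ^+ 2 / 8 :> R.
    have -> : 3^-1 ^+ n = (3 ^+ n)^-1 :> R by rewrite exprVn.
    by field; rewrite expf_neq0.
  by rewrite ler_pdivrMr// mulrC.
have B0 : 0 <= 8 * M by rewrite mulr_ge0// ltW.
have := archi_boundP B0; set n := Num.bound _ => Mn.
have n1 : 1 <= n%:R :> R.
  rewrite ler1n lt0n; apply/eqP => n0.
  by move: Mn; rewrite n0 ltNge B0.
have := nM n; rewrite expr2 => nn.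
have : n%:R <= n%:R * n%:R :> R by rewrite ler_peMr// (le_trans ler01).
by move=> n2; have := lt_le_trans Mn (le_trans n2 nn); rewrite ltxx.
Qed.

(** At distance 1 / (81^n + 1) from the circle the hump satisfies |h|^2 >= (81^n + 1) 9^-n / 8 >=
    9^n / 9, so |h| >= 3^n / 3 >= (n + 1) / 3. *)
Lemma exists_H2b_blowup (x : R[i]) (x1 : modulus x = 1) :
  exists2 h, H2b h & exists m : nat -> nat,
    (forall n, (n <= m n)%N) /\
    forall n, n.+1%:R / 3 <= modulus (h (radial_point x1 (m n))).
Proof.
pose m n := (81 ^ n)%N.
have nm n : (n <= m n)%N by rewrite ltnW// /m ltn_expl.
have zx : tends \oo (fun n => coord (radial_point x1 (m n))) x.
  apply: (@cvgc_le0 _ _ _ _ _ _ (@harmonic R)); last exact: cvg_harmonic.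
  apply: nearW => n; rewrite modulus_sub_radial /harmonic /= lef_pV2 ?posrE ?ltr0n//.
  by rewrite ler_nat ltnS.
have [h Hh hz] := exists_H2b_large x1 zx.
exists h => //; exists m; split => // n.
have := hz n; rewrite one_sub_modulus_radial.
set y := modulus _; have y0 : 0 <= y by exact: modulus_ge0.
have m1 : (3 ^+ n) ^+ 2 * (3 ^+ n) ^+ 2 <= (m n).+1%:R :> R.
  have -> : (3 ^+ n) ^+ 2 * (3 ^+ n) ^+ 2 = (m n)%:R :> R.
    by rewrite -exprD -exprM mulnC exprM /m natrX; congr (_ ^+ n); ring.
  by rewrite ler_nat.
have n3 : n.+1%:R <= 3 ^+ n :> R by rewrite -natrX ler_nat ltn_expl.
have p0 : 0 < 3 ^+ n :> R by rewrite exprn_gt0.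
rewrite exprVn mulrC ler_pdivlMl ?ltr0n//.
move: (3 ^+ n) (m n).+1%:R m1 n3 p0 => t u m1 n3 t0 yu.
have y9 : (t / 3) ^+ 2 <= y ^+ 2.
  have t2 : 0 < t ^+ 2 by rewrite exprn_gt0.
  apply: le_trans yu; apply: le_trans (_ : t ^+ 2 * t ^+ 2 * (8^-1 * t^-1 ^+ 2) <= _).
    have -> : t ^+ 2 * t ^+ 2 * (8^-1 * t^-1 ^+ 2) = t ^+ 2 / 8.
      by field; rewrite gt_eqF.
    by rewrite expr_div_n; lra.
  by apply: ler_wpM2r m1; rewrite mulr_ge0 ?sqr_ge0 ?invr_ge0.
have t3 : t / 3 <= y.
  by rewrite -(@ler_pXn2r _ 2) ?nnegrE ?divr_ge0 ?(ltW t0).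
by apply: le_trans t3; rewrite ler_wpM2r.
Qed.

(** Near a root x, the factor z - x keeps the term with G bounded along the radius, and q is
    bounded; so p h is bounded where h blows up, and p(x) = 0. The hypothesis is stable under
    removal of one root from both p and s, so multiplicities are handled by induction. *)
Lemma dvd_of_multiplier (s : seq R[i]) (p : {poly R[i]}) :
  (forall x, x \in s -> modulus x = 1) ->
  (forall h, H2b h -> exists G (q : {poly R[i]}), tame G /\
     forall z, p.[coord z] * h z =
       (\prod_(x <- s) ('X - x%:P)).[coord z] * G z + q.[coord z]) ->
  exists q, p = (\prod_(x <- s) ('X - x%:P)) * q.
Proof.
elim: s p => [|x s IH] p s1 hp; first by exists p; rewrite big_nil mul1r.
have x1 : modulus x = 1 by apply/s1/mem_head.
have px : p.[x] = 0.
  have [h Hh [m [nm hm]]] := exists_H2b_blowup x1.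
  destruct (hp h Hh) as [G [q [tG E]]].
  set k := \prod_(y <- s) ('X - y%:P).
  have [d d0 Gd] := tameM_poly k tG ltr01.
  have [Q qQ] := poly_bounded q.
  have zx : tends \oo (fun n => coord (radial_point x1 (m n))) x.
    apply: (@cvgc_le0 _ _ _ _ _ _ (@harmonic R)); last exact: cvg_harmonic.
    apply: nearW => n; rewrite modulus_sub_radial /harmonic /= lef_pV2 ?posrE ?ltr0n//.
    by rewrite ler_nat ltnS.
  have pz : tends \oo (fun n => p.[coord (radial_point x1 (m n))]) p.[x].
    exact: tends_horner.
  apply: (cvgc_unique pz).
  (* From |p| (n + 1) / 3 <= |p h| <= 1 + Q, with 1 bounding the term in G and Q the polynomial
     q. *)
  apply: (@cvgc_le0 _ _ _ _ _ _ (fun n => 3 * (1 + Q) * harmonic n)).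
    have := @cvg_harmonic R; move=> /cvgrPdist_lt /(_ _ d0); apply: filterS => n.
    rewrite sub0r normrN ger0_norm /harmonic /=; last by rewrite invr_ge0 ler0n.
    move=> nd; rewrite subr0.
    have zd : 1 - modulus (coord (radial_point x1 (m n))) < d.
      rewrite one_sub_modulus_radial; apply: le_lt_trans nd.
      by rewrite lef_pV2 ?posrE ?ltr0n// ler_nat ltnS.
    have hn := hm n; have n0 : 0 < n.+1%:R :> R by rewrite ltr0n.
    have up : modulus p.[coord (radial_point x1 (m n))] *
              modulus (h (radial_point x1 (m n))) <= 1 + Q.
      move: (Gd _ zd) (modulus_sub_radial x1 (m n)) (one_sub_modulus_radial x1 (m n)).
      move: (radial_point x1 (m n)) => y Gy y1 y2.
      rewrite -modulusM E big_cons hornerM hornerXsubC.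
      apply: le_trans (le_modulusD _ _) _; apply: lerD; last exact: qQ.
      by rewrite -mulrA modulusM y1 -y2.
    rewrite ler_pdivlMr//.
    have := ler_wpM2l (modulus_ge0 p.[coord (radial_point x1 (m n))]) hn.
    rewrite mulrA => lo; have := le_trans lo up.
    by rewrite ler_pdivrMr// [leRHS]mulrC.
  rewrite -[X in _ --> X](mulr0 (3 * (1 + Q))); apply: cvgM.
    exact: cvg_cst.
  exact: cvg_harmonic.
have /eqP/factor_theorem[p' pE] := px.
have [||q' qE] := IH p'.
- by move=> y ys; apply: s1; rewrite inE ys orbT.
- move=> h Hh; destruct (hp h Hh) as [G [q [tG E]]].
  pose k := \prod_(y <- s) ('X - y%:P).
  have tD : tame (fun z => p'.[coord z] * h z - k.[coord z] * G z).
    by apply: tameB; apply: tameM_poly => //; exact: tame_H2 Hh.1.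
  (* After cancelling z - x, q is z - x times a tame function, so that function is the new
     polynomial part. *)
  have qD z : q.[coord z] = (coord z - x) * (p'.[coord z] * h z - k.[coord z] * G z).
    have := E z; rewrite pE big_cons !hornerM hornerXsubC -/k.
    exact: sub_of_eq_add1.
  destruct (tame_division_XsubC x1 tD qD) as [q' _ q'E].
  by exists G, q'; split => // z; rewrite -q'E addrC subrK.
by exists q'; rewrite pE qE big_cons [LHS]mulrC mulrA.
Qed.

End Unbounded.

Theorem theorem1p5 (R : realType) (a1 a2 : {poly R[i]}) (k : disk R -> R[i])
  (ha1 : circle_rooted a1) (ha2 : circle_rooted a2)
  (hk : k = (fun z => poly_on_disk a2 z / poly_on_disk a1 z))
  (hkb : Hinfty k) :
  multipliers (poly_on_disk a1) (poly_on_disk a2) =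
  [set (fun z => k z * psi z) | psi in range_space (poly_on_disk a1) `&` @Hinfty R].
Proof.
have modE (s : seq R[i]) : (forall x, x \in s -> `|x| = 1) ->
    forall x, x \in s -> modulus x = 1.
  by move=> s1 x /s1; rewrite normcE_modulus => /complexI.
have [s1 /modE s1E a1E] := ha1; have [s2 /modE s2E a2E] := ha2.
have a1n0 (z : disk R) : a1.[coord z] != 0.
  rewrite a1E horner_prod prodf_seq_neq0; apply/allP => x xs /=.
  by rewrite hornerXsubC disk_neq_circle// s1E.
have kE z : a2.[coord z] = a1.[coord z] * k z.
  by rewrite hk !poly_on_diskE mulrCA divff// mulr1.
have [_ [Mk kM]] := hkb.
(* Bounded functions are tame, so division applies to a2 = a1 k. *)
have [kk a2k kkE] : exists2 q, a2 = a1 * q & forall z, k z = q.[coord z].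
  by rewrite a1E; apply: tame_division => //; [exact: tame_bounded kM|
    rewrite -a1E].
have m1 := circle_rooted_monic ha1; have m2 := circle_rooted_monic ha2.
have mk : kk \is monic by move: m2; rewrite a2k monicMl.
(* A monic divisor of a2 is the product over a sublist of its roots, so the roots of k are on the
   circle. *)
have [s3 s3E kkP] : exists2 s : seq R[i], (forall x, x \in s -> modulus x = 1) &
    kk = \prod_(x <- s) ('X - x%:P).
  have kd : kk %| \prod_(x <- s2) ('X - x%:P) by rewrite -a2E a2k dvdp_mull.
  have [m mE] := dvdp_prod_XsubC kd; exists (mask m s2).
    by move=> x /mem_mask; exact: s2E.
  by apply/eqP; rewrite -eqp_monic// monic_prod_XsubC.
apply/seteqP; split => phi.
  move=> [phia phiM].
  have split h : H2b h -> exists g (p : {poly R[i]}), H2b g /\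
      forall z, phi z * (a1.[coord z] * h z) = a2.[coord z] * g z + p.[coord z].
    move=> Hh; apply: range_space_split => //; apply: phiM.
    by apply: (range_space_of_split (p := 0) ha1 Hh) => z; rewrite horner0 addr0.
  (* The expansion of phi comes from multiplying the constant 1, a member of M(conj a1). *)
  have [g [p [Hg phiE]]] : exists g (p : {poly R[i]}), H2b g /\
      forall z, phi z = a2.[coord z] * g z + p.[coord z].
    have r1 : range_space (poly_on_disk a1) (fun=> 1).
      apply: (range_space_of_split (p := 1) ha1 (H2b_poly 0)) => z.
      by rewrite poly_on_diskE horner0 mulr0 add0r hornerC.
    have [g [p [Hg gE]]] := range_space_split ha2 (phiM _ r1).
    by exists g, p; split => // z; rewrite -gE mulr1.
  have [p' pE] : exists p', p = kk * p'.
    rewrite kkP; apply: dvd_of_multiplier => // h Hh.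
    destruct (split h Hh) as [gh [ph [Hgh ghE]]].
    (* Inserting phi = a1 kk g + p into the expansion of phi a1 h and dividing by a1 gives p h - kk
       G = ph / a1. The left side is tame, because g h is, so the quotient ph / a1 is a
       polynomial. *)
    pose G z := gh z - a1.[coord z] * (g z * h z).
    have tG : tame G.
      apply: tameB; first exact: tame_H2 Hgh.1.
      by apply: tameM_poly; exact: tame_H2M Hg.1 Hh.1.
    have tD : tame (fun z => p.[coord z] * h z - kk.[coord z] * G z).
      by apply: tameB; apply: tameM_poly => //; exact: tame_H2 Hh.1.
    have phD z : ph.[coord z] = a1.[coord z] * (p.[coord z] * h z - kk.[coord z] * G z).
      have := ghE z; rewrite phiE a2k hornerM.
      exact: sub_of_eq_add2.
    rewrite a1E in phD; destruct (tame_division s1E tD phD) as [q _ qE].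
    by exists G, q; split => // z; rewrite -kkP -qE addrC subrK.
  pose psi z := a1.[coord z] * g z + p'.[coord z].
  have phi_psi z : phi z = k z * psi z.
    by rewrite phiE kkE pE a2k !hornerM /psi mulrDr mulrA [kk.[_] * a1.[_]]mulrC.
  have Hpsi : H2b psi by apply: H2bD (H2b_poly p'); exact: H2b_polyM.
  exists psi; last by apply/funext => z; rewrite phi_psi.
  split; first exact: range_space_of_split ha1 Hg _.
  split; first exact: Hpsi.1.1.
  apply: multiplier_bounded; first exact: Hpsi.1.1.
  move=> h Hh; destruct (split h Hh) as [gh [ph [Hgh ghE]]].
  (* Here psi h - gh = ph / a2 is tame, hence a polynomial, which puts psi h in H^2. *)
  have tD : tame (fun z => psi z * h z - gh z).
    by apply: tameB; [exact: tame_H2M Hpsi.1 Hh.1|exact: tame_H2 Hgh.1].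
  have phD z : ph.[coord z] = a2.[coord z] * (psi z * h z - gh z).
    have := ghE z; rewrite phi_psi kkE a2k hornerM.
    exact: sub_of_eq_add3.
  rewrite a2E in phD; destruct (tame_division s2E tD phD) as [q _ qE].
  have -> : (fun z => psi z * h z) = fun z => gh z + poly_on_disk q z.
    by apply/funext => z; rewrite poly_on_diskE -qE addrC subrK.
  exact: H2D Hgh.1 (H2_poly q).
move=> [psi [psi1 psib] <-]; split; first exact: analyticM hkb.1 psib.1.
move=> f f1; have [u [p1 [Hu fE]]] := range_space_split ha1 f1.
have [v [p2 [Hv psiE]]] := range_space_split ha1 psi1.
have Hpsi : H2b psi.
  have -> : psi = fun z => a1.[coord z] * v z + poly_on_disk p2 z.
    by apply/funext => z; rewrite psiE.
  by apply: H2bD (H2b_poly p2); exact: H2b_polyM.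
(* With f = a1 u + p1 and psi = a1 v + p2, k psi f = a2 (psi u + p1 v) + kk p2 p1. Boundedness of
   psi keeps psi u in H^2. *)
apply: (range_space_of_split (p := kk * p2 * p1)
  (h := fun z => psi z * u z + p1.[coord z] * v z) ha2).
  by apply: H2bD; [exact: H2bM|exact: H2b_polyM].
move=> z; rewrite fE kkE a2k !hornerM psiE.
exact: mul_split.
Qed.
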